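(* Suppose that $(Y_t)_{t\in\mathbb Z}$ and $(Y_t^{(n)})_{t\in\mathbb Z}$, $n\in\mathbb N$, are stationary real-valued Markov processes of order $p$, defined on probability spaces $(\Omega,\mathcal A,P)$ and $(\Omega_n,\mathcal A_n,P_n)$, respectively. Suppose that (i) for all compact sets $K\subseteq\mathbb R^p$, $$\sup_{y\in K}d\big(P_n^{Y_t^{(n)}\mid Y^{(n)}_{t-1}=y_1,\dots,Y^{(n)}_{t-p}=y_p},\,P^{Y_t\mid Y_{t-1}=y_1,\dots,Y_{t-p}=y_p}\big)\xrightarrow[n\to\infty]{}0;$$ (ii) for all $y\in\mathbb R^p$, $$\sup_{\widetilde y:\|\widetilde y-y\|\le\delta}d\big(P^{Y_t\mid Y_{t-1}=y_1,\dots,Y_{t-p}=y_p},\,P^{Y_t\mid Y_{t-1}=\widetilde y_1,\dots,Y_{t-p}=\widetilde y_p}\big)\xrightarrow[\delta\to0]{}0;$$ (iii) $(P_n^{Y_t^{(n)}})_{n\in\mathbb N}$ is tight; (iv) there is a unique stationary distribution $P^{Y_1,\dots,Y_p}$ that corresponds to the transition kernel $P^{Y_t\mid Y_{t-1},\dots,Y_{t-p}}$. Then, for all $k\in\mathbb N$, $$P_n^{Y_1^{(n)},\dots,Y_k^{(n)}}\Longrightarrow P^{Y_1,\dots,Y_k}\qquad(n\to\infty).$$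
   Context: $P^{Z}$ denotes the law of $Z$ under $P$, $P^{Z\mid W=w}$ a (fixed version of the) regular conditional law, and $\Longrightarrow$ weak convergence. For probability distributions $P,Q$ on $\mathbb R^m$, $d(P,Q)=\inf E[\|X-Y\|\wedge1]$, the infimum taken over all pairs $(X,Y)$ with $X\sim P$ and $Y\sim Q$, where $\|\cdot\|$ is any norm on $\mathbb R^m$ (in (i), (ii) it is used with $m=1$). *)

(* Defs.v *)
From HB Require Import structures.
From mathcomp Require Import all_boot all_order all_algebra.
From mathcomp Require Import all_classical all_reals all_analysis measurable_realfun.

Set Implicit Arguments.
Unset Strict Implicit.
Unset Printing Implicit Defensive.

Import Order.TTheory GRing.Theory Num.Theory.
Import numFieldNormedType.Exports.

Local Open Scope classical_set_scope.
Local Open Scope ring_scope.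

(* R^n is 'rV[R]_n with the product sigma-algebra, as the library does for
   n.-tuple; it coincides with the Borel sigma-algebra of 'rV[R]_n. *)
Section measurable_rV.
Context {R : realType} (n : nat).

Let coord (i : 'I_n) (x : 'rV[R]_n) : R := x ord0 i.

Let rV_set0 : g_sigma_preimage coord set0.
Proof. exact: sigma_algebra0. Qed.

Let rV_setC A : g_sigma_preimage coord A -> g_sigma_preimage coord (~` A).
Proof. exact: sigma_algebraC. Qed.

Let rV_bigcup (F : (set 'rV[R]_n)^nat) :
  (forall i, g_sigma_preimage coord (F i)) ->
  g_sigma_preimage coord (\bigcup_i (F i)).
Proof. exact: sigma_algebra_bigcup. Qed.

HB.instance Definition _ := @isMeasurable.Build default_measure_display
  'rV[R]_n (g_sigma_preimage coord) rV_set0 rV_setC rV_bigcup.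

End measurable_rV.

Lemma measurable_fun_rV d (T : measurableType d) (R : realType) n
    (X : T -> 'rV[R]_n) :
  (forall i, measurable_fun [set: T] (fun w => X w ord0 i)) ->
  measurable_fun [set: T] X.
Proof.
move=> mX.
have : g_sigma_preimage (fun i w => X w ord0 i) `<=` measurable.
  apply: smallest_sub; first exact: sigma_algebra_measurable.
  case: n => [|n] in X mX *; first by rewrite big_ord0.
  rewrite -bigcup_mkord_ord; apply: bigcup_sub => i _ A [B mB <-].
  exact: mX.
rewrite (g_sigma_preimage_comp (fun i (x : 'rV[R]_n) => x ord0 i) X).
by move=> sX _ A mA; apply: sX; exists A.
Qed.

Section processes.
Context d (Omega : measurableType d) (R : realType) (P : probability Omega R).
Variable Y : int -> {RV P >-> R}.

Definition rvec k (s : 'I_k -> int) (w : Omega) : 'rV[R]_k :=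
  \row_(i < k) Y (s i) w.

Lemma measurable_rvec k (s : 'I_k -> int) : measurable_fun [set: Omega] (rvec s).
Proof.
apply: measurable_fun_rV => i.
by under eq_fun do rewrite mxE; exact: measurable_funPT.
Qed.

HB.instance Definition _ k (s : 'I_k -> int) :=
  isMeasurableFun.Build _ _ _ _ (rvec s) (measurable_rvec s).

Definition law k (s : 'I_k -> int) : probability 'rV[R]_k R :=
  distribution P (rvec s).

(* (Y_1, ..., Y_k) *)
Definition law1 k : probability 'rV[R]_k R :=
  law (fun i : 'I_k => i.+1%:Z).

(* (Y_{t-1}, ..., Y_{t-p}) *)
Definition lags p (t : int) : {RV P >-> 'rV[R]_p} :=
  rvec (fun i : 'I_p => t - i.+1%:Z).

Definition stationary : Prop :=
  forall k (s : 'I_k -> int) (h : int) (A : set 'rV[R]_k), measurable A ->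
    law (fun i => s i + h) A = law s A.

(* g is a version of the conditional probability P(E | G) *)
Definition is_cond_prob (G : set_system Omega) (E : set Omega)
    (g : Omega -> \bar R) : Prop :=
  [/\ forall B : set (\bar R), measurable B -> G (g @^-1` B),
      P.-integrable [set: Omega] g &
      forall B, G B -> (\int[P]_(w in B) g w = P (E `&` B))%E].

Definition sigma_lags p (t : int) : set_system Omega :=
  preimage_set_system [set: Omega] (lags p t) measurable.

Definition sigma_past (t : int) : set_system Omega :=
  <<s \bigcup_(s in [set s : int | s < t])
        preimage_set_system [set: Omega] (Y s) measurable >>.

(* P(Y_t \in A | Y_s, s < t) = P(Y_t \in A | Y_{t-1}, ..., Y_{t-p}) a.s. *)
Definition markov_of_order p : Prop :=
  forall (t : int) (A : set R) (g : Omega -> \bar R), measurable A ->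
    is_cond_prob (sigma_lags p t) (Y t @^-1` A) g ->
    is_cond_prob (sigma_past t) (Y t @^-1` A) g.

(* kappa y is the law of Y_t given Y_{t-1} = y_1, ..., Y_{t-p} = y_p, the same
   version being used for all t *)
Definition transition_kernel p (kappa : R.-pker 'rV[R]_p ~> R) : Prop :=
  forall (t : int) (A : set R), measurable A ->
    is_cond_prob (sigma_lags p t) (Y t @^-1` A)
      (fun w => kappa (lags p t w) A).

End processes.

Section metric_d.
Context (R : realType).

Definition is_norm (V : lmodType R) (N : V -> R) : Prop :=
  [/\ forall x, N x = 0 -> x = 0,
      forall a x, N (a *: x) = `|a| * N x &
      forall x y, N (x + y) <= N x + N y].

Definition dist_d (N : R -> R) (mu nu : {measure set R -> \bar R}) : \bar R :=
  ereal_inf [set e : \bar R |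
    exists d (T : measurableType d) (Q : probability T R) (X Y : {RV Q >-> R}),
      [/\ forall A, measurable A -> distribution Q X A = mu A,
          forall A, measurable A -> distribution Q Y A = nu A &
          e = ('E_Q[(fun w => Num.min (N (X w - Y w)) 1)%R])%E]].

End metric_d.

Section limits.
Context (R : realType).

Definition tight (mu : nat -> probability R R) : Prop :=
  forall e : R, 0 < e ->
    exists2 K : set R, compact K & forall n, (mu n (~` K) <= e%:E)%E.

Definition weak_cvg k (mu : nat -> probability 'rV[R]_k R)
    (nu : probability 'rV[R]_k R) : Prop :=
  forall f : 'rV[R]_k -> R, continuous f -> bounded_fun f ->
    (\int[mu n]_x (f x)%:E)%E @[n --> \oo] --> (\int[nu]_x (f x)%:E)%E.

End limits.

Section stationary_distributions.
Context (R : realType) (p : nat).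

(* (x_1, ..., x_p), z |-> (x_2, ..., x_p, z) *)
Definition shift_in (x : 'rV[R]_p) (z : R) : 'rV[R]_p :=
  \row_(i < p) (if insub i.+1 is Some j then x ord0 j else z).

(* (x_1, ..., x_p) |-> (x_p, ..., x_1), since a transition kernel takes the
   most recent value as its first coordinate *)
Definition rev_rV (x : 'rV[R]_p) : 'rV[R]_p := \row_(i < p) x ord0 (rev_ord i).

(* if (X_1, ..., X_p) has law nu and X_{p+1} is drawn from
   kappa (X_p, ..., X_1), then (X_2, ..., X_{p+1}) has law nu *)
Definition stationary_distribution (kappa : R.-pker 'rV[R]_p ~> R)
    (nu : probability 'rV[R]_p R) : Prop :=
  forall A : set 'rV[R]_p, measurable A ->
    nu A = (\int[nu]_x kappa (rev_rV x) [set z | A (shift_in x z)])%E.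

End stationary_distributions.

(* Main.v *)
Require Import Defs.
From HB Require Import structures.
From mathcomp Require Import all_boot all_order all_algebra.
From mathcomp Require Import all_classical all_reals all_analysis.
From mathcomp Require Import measurable_realfun.
From mathcomp Require Import ring lra zify.

Set Implicit Arguments.
Unset Strict Implicit.
Unset Printing Implicit Defensive.

Import Order.TTheory GRing.Theory Num.Theory.
Import numFieldNormedType.Exports.

Local Open Scope classical_set_scope.
Local Open Scope ring_scope.

(** The laws of the first [p] values of the approximating processes are tight,
so along any ultrafilter [U] on the indices that refines [n --> oo] the means
of every bounded continuous function converge, and tightness makes the limit
functional the integral against a probability [nu] ([tight_ultra_limit]).

By the Markov property the law of the first [k+1] values is the law of the
first [k] values followed by one draw from the transition kernel
([law1_succ]).  The two hypotheses on the distance between kernels are turned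
into statements about test functions through couplings: the mean of [f (x, .)]
under the limit kernel at [x] is continuous in [x], and the means under the
approximating kernels converge to it uniformly on compact sets
([kmean_continuous], [kmean_uniform]).  Hence weak convergence of the first [k]
values passes to the first [k+1] values ([semidirect_cvg]).

Applied to [k = p] along [U], this says that the first [p+1] values converge
to [nu] followed by a draw from the limit kernel; since each approximating
process is stationary, forgetting the first value must give back [nu]
([ultra_limit_stationary]).  So [nu] is a stationary distribution, and by
uniqueness it is the law of the first [p] values of the limit process,
whatever [U] is.  Convergence along all ultrafilters is convergence, which
settles [k = p] ([law1_cvg_order]); larger [k] follow by induction with the
same one-step result, and smaller [k] by projection.

Ultrafilters stand in for the extraction of subsequences.  Compactness of
tight sequences rests on the representation of the limit functional
([riesz_probability]): the measure comes from Caratheodory's construction,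
applied to the outer measure that covers sets by increasing sequences of
bounded continuous functions. *)

(** * Means of bounded measurable functions *)

Section bounded_measurable.
Context d (T : measurableType d) (R : realType).
Implicit Types (f g : T -> R) (P : probability T R).

Definition bounded_measurable f :=
  measurable_fun [set: T] f /\ exists B, forall x, `|f x| <= B.

Lemma bm_cst (c : R) : bounded_measurable (fun=> c).
Proof. by split; [exact: measurable_cst|exists `|c|]. Qed.

Lemma bmD f g : bounded_measurable f -> bounded_measurable g ->
  bounded_measurable (fun x => f x + g x).
Proof.
move=> [mf [B fB]] [mg [C gC]]; split; first exact: measurable_funD.
by exists (B + C) => x; rewrite (le_trans (ler_normD _ _))// lerD.
Qed.

Lemma bmM f g : bounded_measurable f -> bounded_measurable g ->
  bounded_measurable (fun x => f x * g x).
Proof.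
move=> [mf [B fB]] [mg [C gC]]; split; first exact: measurable_funM.
by exists (B * C) => x; rewrite normrM ler_pM.
Qed.

Lemma bmZ (c : R) f : bounded_measurable f ->
  bounded_measurable (fun x => c * f x).
Proof. by move=> bf; apply: bmM => //; exact: bm_cst. Qed.

Lemma bmB f g : bounded_measurable f -> bounded_measurable g ->
  bounded_measurable (fun x => f x - g x).
Proof.
move=> bf bg; rewrite (_ : (fun _ => _) = fun x => f x + -1 * g x).
  by apply: bmD => //; exact: bmZ.
by apply/funext => x; rewrite mulN1r.
Qed.

Lemma bm_norm f : bounded_measurable f -> bounded_measurable (fun x => `|f x|).
Proof.
move=> [mf [B fB]]; split; last by exists B => x; rewrite normr_id.
exact: measurableT_comp.
Qed.

Lemma bm_indic (A : set T) : measurable A -> bounded_measurable (\1_A : T -> R).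
Proof.
move=> mA; split; first exact: measurable_indic.
by exists 1 => x; rewrite indicE; case: (x \in A); rewrite ?normr1 ?normr0.
Qed.

Lemma bm_integrable P f : bounded_measurable f ->
  P.-integrable [set: T] (EFin \o f).
Proof.
move=> [mf [B fB]]; apply: measurable_bounded_integrable => //.
  by rewrite ltey_eq fin_num_measure.
exists B; split; first by rewrite num_real.
by move=> y By x _ /=; rewrite (le_trans (fB x))// ltW.
Qed.

Lemma bm_integralE P f : bounded_measurable f ->
  (\int[P]_x (f x)%:E)%E = (\int[P]_x f x)%:E.
Proof.
by move=> bf; rewrite /Rintegral fineK// integrable_fin_num//;
  exact: bm_integrable.
Qed.

Lemma mean_cst P (c : R) : \int[P]_x c = c.
Proof. by rewrite Rintegral_cst// [X in fine X]probability_setT mulr1. Qed.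

Lemma meanD P f g : bounded_measurable f -> bounded_measurable g ->
  \int[P]_x (f x + g x) = \int[P]_x f x + \int[P]_x g x.
Proof. by move=> bf bg; rewrite RintegralD//; exact: bm_integrable. Qed.

Lemma meanB P f g : bounded_measurable f -> bounded_measurable g ->
  \int[P]_x (f x - g x) = \int[P]_x f x - \int[P]_x g x.
Proof. by move=> bf bg; rewrite RintegralB//; exact: bm_integrable. Qed.

Lemma meanZ P (c : R) f : bounded_measurable f ->
  \int[P]_x (c * f x) = c * \int[P]_x f x.
Proof. by move=> bf; rewrite RintegralZl//; exact: bm_integrable. Qed.

Lemma mean_le P f g : bounded_measurable f -> bounded_measurable g ->
  (forall x, f x <= g x) -> \int[P]_x f x <= \int[P]_x g x.
Proof. by move=> bf bg fg; apply: le_Rintegral => //; exact: bm_integrable. Qed.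

Lemma mean_norm P f : bounded_measurable f ->
  `|\int[P]_x f x| <= \int[P]_x `|f x|.
Proof. by move=> bf; apply: le_normr_Rintegral => //; exact: bm_integrable. Qed.

Lemma mean_le_cst P f (B : R) :
  bounded_measurable f -> (forall x, `|f x| <= B) -> `|\int[P]_x f x| <= B.
Proof.
move=> bf fB; rewrite (le_trans (mean_norm _ bf))// -[leRHS](mean_cst P).
by apply: mean_le => //; [exact: bm_norm|exact: bm_cst].
Qed.

Lemma mean_indic P (A : set T) : measurable A ->
  (\int[P]_x (\1_A x : R))%:E = P A.
Proof.
by move=> mA; rewrite -bm_integralE ?integral_indic ?setIT//; exact: bm_indic.
Qed.

Lemma eq_mean P f g : f =1 g -> \int[P]_x f x = \int[P]_x g x.
Proof. by move=> fg; apply: eq_Rintegral => x _. Qed.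

End bounded_measurable.

Lemma bm_comp d d' (T : measurableType d) (T' : measurableType d')
    (R : realType) (phi : T' -> T) (f : T -> R) :
  measurable_fun [set: T'] phi -> bounded_measurable f ->
  bounded_measurable (f \o phi).
Proof.
move=> mphi [mf [B fB]]; split; first exact: measurableT_comp.
by exists B => x /=.
Qed.

Lemma mean_distribution d d' (T : measurableType d) (T' : measurableType d')
    (R : realType) (P : probability T R) (X : {RV P >-> T'}) (f : T' -> R) :
  bounded_measurable f -> \int[distribution P X]_y f y = \int[P]_x f (X x).
Proof.
move=> bf; rewrite /Rintegral integral_distribution//.
  by case: bf => mf _; exact/measurable_EFinP.
have : bounded_measurable (f \o X).
  by apply: bm_comp => //; exact: measurable_funPT.
exact: bm_integrable.
Qed.

Lemma eq_mean_measure d (T : measurableType d) (R : realType)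
    (mu nu : probability T R) (f : T -> R) :
  (forall A, measurable A -> mu A = nu A) -> \int[mu]_x f x = \int[nu]_x f x.
Proof.
by move=> mn; congr fine; apply: eq_measure_integral => A mA _; exact: mn.
Qed.

Lemma mean_sum d (T : measurableType d) (R : realType) (P : probability T R)
    (I : Type) (s : seq I) (f : I -> T -> R) :
  (forall i, bounded_measurable (f i)) ->
  bounded_measurable (fun x => \sum_(i <- s) f i x) /\
  \int[P]_x (\sum_(i <- s) f i x) = \sum_(i <- s) \int[P]_x f i x.
Proof.
move=> bf; elim: s => [|i s [bs IHs]].
  rewrite big_nil (_ : (fun _ => _) = fun=> 0).
    by split; [exact: bm_cst|exact: mean_cst].
  by apply/funext => x; rewrite big_nil.
rewrite (_ : (fun x => _) = fun x => f i x + \sum_(j <- s) f j x).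
  by split; [exact: bmD|rewrite meanD// big_cons IHs].
by apply/funext => x; rewrite big_cons.
Qed.

(** The bounded convergence theorem for real-valued means. *)
Lemma mean_dominated d (T : measurableType d) (R : realType)
    (P : probability T R) (f_ : nat -> T -> R) (f : T -> R) (B : R) :
  (forall n, bounded_measurable (f_ n)) -> bounded_measurable f ->
  (forall n x, `|f_ n x| <= B) -> (forall x, f_ n x @[n --> \oo] --> f x) ->
  \int[P]_x f_ n x @[n --> \oo] --> \int[P]_x f x.
Proof.
move=> bf_ bf fB ff.
have [|||||_ _] := @dominated_convergence _ T R P setT measurableT
   (fun n x => (f_ n x)%:E) (fun x => (f x)%:E) (cst B%:E) .
- by move=> n; apply/measurable_EFinP; case: (bf_ n).
- by apply/measurable_EFinP; case: bf.
- by apply: aeW => x _; apply: cvg_EFin; [exact: nearW|exact: ff].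
- exact: (bm_integrable P (bm_cst T B)).
- by apply: aeW => x n _; rewrite /= lee_fin.
by move=> h; apply: fine_cvg; rewrite -bm_integralE.
Qed.

(** * The Borel structure of row vectors *)

Section borel_rV.
Context {R : realType} (k : nat).
Implicit Types (x : 'rV[R]_k) (f : 'rV[R]_k -> R).

Lemma measurable_coord (i : 'I_k) :
  measurable_fun [set: 'rV[R]_k] (fun x => x ord0 i).
Proof.
move=> _ B mB; rewrite setTI; apply: sub_sigma_algebra.
by rewrite (bigD1 i)//=; left; exists B => //; rewrite setTI.
Qed.

(** The coordinate rays generate the product sigma-algebra; stated as a closure
principle so that it serves both for the uniqueness of a probability and for
Caratheodory measurability. *)
Lemma rV_measurable_sub (C : set_system 'rV[R]_k) : sigma_algebra setT C ->
  (forall i a, C [set x | a < x ord0 i]) -> measurable `<=` C.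
Proof.
move=> [C0 CD CU] Cray; apply: smallest_sub; first by split.
apply: (big_ind (fun S : set_system 'rV[R]_k => S `<=` C)) => //.
  by move=> S1 S2 S1C S2C; rewrite subUset.
move=> i _ _ [B mB <-]; rewrite setTI.
suff : measurable `<=` [set B : set R | C ((fun x => x ord0 i) @^-1` B)].
  exact.
have -> : @measurable _ R = <<s @RGenOInfty.G R >> := RGenOInfty.measurableE R.
apply: smallest_sub.
  split => /=.
  - by rewrite preimage_set0.
  - by move=> S; rewrite setTD preimage_setC -setTD; exact: CD.
  - by move=> F CF; rewrite preimage_bigcup; exact: CU.
move=> _ [a ->]; apply: (eq_ind _ C (Cray i a)).
by apply/seteqP; split => x /=; rewrite in_itv/= andbT.
Qed.

(** An open set is the union of the boxes with rational centre and radius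
[1/(n+1)] that it contains, and there are countably many of them. *)
Lemma open_measurable_rV (O : set 'rV[R]_k) : open O -> measurable O.
Proof.
move=> oO.
pose box (qn : 'rV[rat]_k * nat) : set 'rV[R]_k :=
  \bigcap_(i in [set: 'I_k])
    [set x | `|x ord0 i - ratr (qn.1 ord0 i)| < qn.2.+1%:R^-1].
have mbox qn : measurable (box qn).
  apply: fin_bigcap_measurable => // i _.
  rewrite [X in measurable X](_ : _ = (fun x : 'rV[R]_k => x ord0 i) @^-1`
      ball (ratr (qn.1 ord0 i) : R) qn.2.+1%:R^-1).
    rewrite -[X in measurable X]setTI; apply: measurable_coord => //.
    exact: measurable_ball.
  by apply/seteqP; split => x; rewrite /ball /= distrC.
rewrite (_ : O = \bigcup_qn (if `[< box qn `<=` O >] then box qn else set0)).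
  apply: countable_bigcupT_measurable; first exact: countableP.
  by move=> qn; case: ifP.
apply/seteqP; split => [x Ox|x [qn _]]; last first.
  by case: ifPn => // /asboolP; exact.
have /nbhs_ballP[e /= e0 eO] := open_nbhs_nbhs (conj oO Ox).
have [n _ /(_ n (leqnn n)) ne] :=
  near_infty_natSinv_lt (PosNum (divr_gt0 e0 (ltr0n _ 2))).
have n0 : 0 < n.+1%:R^-1 :> R by rewrite invr_gt0.
have /(_ _) /cid-/all_sig[q qx] : forall i : 'I_k, exists q : rat,
    ratr q \in `]x ord0 i - n.+1%:R^-1, x ord0 i + n.+1%:R^-1[%R.
  by move=> i; apply: rat_in_itvoo; rewrite ltrBlDr -addrA ltrDl addr_gt0.
exists (\row_i q i, n) => //; case: ifPn => [_ i _ /=|/asboolP[]].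
  rewrite mxE; move: (qx i); rewrite in_itv/= ltr_distl => /andP[h1 h2].
  by rewrite ltrBlDr h2 -ltrBlDr h1.
move=> y ybox; apply: eO; split => // i j; rewrite ord1.
have := ybox j I; move: (qx j); rewrite /= mxE in_itv/= => /andP[h1 h2].
rewrite /ball /= /= ltr_distl => /andP[h3 h4].
move: ne; rewrite /= ltr_distl; move: h1 h2 h3 h4.
move: (x ord0 j) (y ord0 j) (ratr (q j)) n.+1%:R^-1 => s t u r h1 h2 h3 h4 ne.
by apply/andP; split; lra.
Qed.

Lemma continuous_measurable_rV f : continuous f -> measurable_fun setT f.
Proof.
move=> /continuousP cf; apply: (measurability _ (RGenOInfty.measurableE R)).
move=> _ [_ [a ->] <-]; rewrite setTI; apply: open_measurable_rV; apply: cf.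
exact: interval_open.
Qed.

Definition bounded_continuous f :=
  continuous f /\ exists B, forall x, `|f x| <= B.

Lemma bc_bm f : bounded_continuous f -> bounded_measurable f.
Proof. by move=> [cf bf]; split => //; exact: continuous_measurable_rV. Qed.

(** The pi-lambda theorem for a pi-system that contains the coordinate rays. *)
Lemma probability_rV_eq (mu nu : probability 'rV[R]_k R)
    (D : set_system 'rV[R]_k) :
  setI_closed D -> D `<=` measurable -> D setT ->
  (forall i a, D [set x | a < x ord0 i]) ->
  (forall A, D A -> mu A = nu A) ->
  forall A, measurable A -> mu A = nu A.
Proof.
move=> DI mD DT Dray Deq A mA.
apply: (measure_unique D (fun=> setT)) => //.
- apply/seteqP; split; last first.
    by apply: smallest_sub => //; exact: sigma_algebra_measurable.
  apply: rV_measurable_sub; first exact: smallest_sigma_algebra.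
  by move=> i a; exact: sub_sigma_algebra.
- by rewrite bigcup_const.
- by move=> n; rewrite ltey_eq fin_num_measure.
Qed.

Lemma bc_cst (c : R) : bounded_continuous (fun=> c).
Proof. by split; [exact: cst_continuous|exists `|c|]. Qed.

Lemma bcD f g : bounded_continuous f -> bounded_continuous g ->
  bounded_continuous (fun x => f x + g x).
Proof.
move=> [cf [B fB]] [cg [C gC]]; split.
  by move=> x; apply: continuousD; [exact: cf|exact: cg].
by exists (B + C) => x; rewrite (le_trans (ler_normD _ _))// lerD.
Qed.

Lemma bcM f g : bounded_continuous f -> bounded_continuous g ->
  bounded_continuous (fun x => f x * g x).
Proof.
move=> [cf [B fB]] [cg [C gC]]; split.
  by move=> x; apply: continuousM; [exact: cf|exact: cg].
by exists (B * C) => x; rewrite normrM ler_pM.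
Qed.

Lemma bcZ (c : R) f : bounded_continuous f ->
  bounded_continuous (fun x => c * f x).
Proof. by move=> bf; apply: bcM => //; exact: bc_cst. Qed.

Lemma bcB f g : bounded_continuous f -> bounded_continuous g ->
  bounded_continuous (fun x => f x - g x).
Proof.
move=> bf bg; rewrite (_ : (fun _ => _) = fun x => f x + -1 * g x).
  by apply: bcD => //; exact: bcZ.
by apply/funext => x; rewrite mulN1r.
Qed.

Lemma bc_min f g : bounded_continuous f -> bounded_continuous g ->
  bounded_continuous (fun x => Num.min (f x) (g x)).
Proof.
move=> [cf [B fB]] [cg [C gC]]; split.
  by move=> x; apply: continuous_min; [exact: cf|exact: cg].
exists (Num.max B C) => x; rewrite le_max; case: (leP (f x) (g x)) => _.
  by rewrite fB.
by rewrite gC orbT.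
Qed.

End borel_rV.

(** Bounded continuous functions increasing to the indicator of a coordinate
ray: they let continuous test functions see the generators of the
sigma-algebra. *)
Definition ray_fun {R : realType} k (i : 'I_k) (a : R) (m : nat)
    (x : 'rV[R]_k) : R :=
  Num.min 1 (Num.max 0 (m%:R * (x ord0 i - a))).

Section ray_fun.
Context {R : realType} (k : nat) (i : 'I_k) (a : R).
Notation h := (ray_fun i a).

Lemma ray_fun_ge0 m x : 0 <= h m x.
Proof. by rewrite le_min ler01 le_max lexx. Qed.

Lemma ray_fun_le1 m x : h m x <= 1.
Proof. by rewrite ge_min lexx. Qed.

Lemma ray_fun_bc m : bounded_continuous (h m).
Proof.
split; last first.
  by exists 1 => x; rewrite ger0_norm ?ray_fun_le1// ray_fun_ge0.
pose u := fun y : 'rV[R]_k => m%:R * (y ord0 i - a).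
have cu : continuous u.
  move=> x; apply: (continuousM (s := fun=> m%:R)
    (t := fun y : 'rV[R]_k => y ord0 i - a)).
    exact: cst_continuous.
  apply: (continuousB (f := fun y : 'rV[R]_k => (y ord0 i : R^o))
    (g := fun=> a)).
    exact: coord_continuous.
  exact: cst_continuous.
suff : continuous ((fun=> 1) \min ((fun=> 0) \max u)) by [].
move=> x; apply: continuous_min; first exact: cst_continuous.
by apply: continuous_max; [exact: cst_continuous|exact: cu].
Qed.

Lemma ray_fun_out m (x : 'rV[R]_k) : x ord0 i <= a -> h m x = 0.
Proof.
move=> xa; rewrite /ray_fun; have -> : Num.max 0 (m%:R * (x ord0 i - a)) = 0.
  by apply/max_idPl; rewrite mulr_ge0_le0// subr_le0.
by apply/min_idPr; exact: ler01.
Qed.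

Lemma ray_fun_in (x : 'rV[R]_k) :
  a < x ord0 i -> \forall m \near \oo, h m x = 1.
Proof.
move=> ax; have xa0 : 0 < x ord0 i - a by rewrite subr_gt0.
near=> m; apply/min_idPl; rewrite le_max; apply/orP; right.
rewrite -ler_pdivrMr//; near: m; exact: nbhs_infty_ger.
Unshelve. all: by end_near. Qed.

Lemma ray_fun_nd m n x : (m <= n)%N -> h m x <= h n x.
Proof.
move=> mn; rewrite /ray_fun; have [xa|ax] := leP (x ord0 i) a.
  by rewrite -/(h m x) -/(h n x) !ray_fun_out.
rewrite le_min ge_min lexx/= ge_min; apply/orP; right.
rewrite ge_max !le_max lexx/=; apply/orP; right.
by rewrite ler_wpM2r ?ler_nat// subr_ge0 ltW.
Qed.

Lemma ray_fun_cvg x : h m x @[m --> \oo] --> (\1_[set x | a < x ord0 i] x : R).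
Proof.
have [xa|ax] := leP (x ord0 i) a.
  rewrite indicE memNset/=; last by rewrite ltNge xa.
  rewrite (_ : (fun m => _) = cst 0); first exact: cvg_cst.
  by apply/funext => m; exact: ray_fun_out.
rewrite indicE mem_set//=; apply: cvg_near_cst; exact: ray_fun_in.
Qed.

End ray_fun.

(** The sets whose indicator is a pointwise limit of continuous functions with
values between 0 and 1 are stable under intersection, because limits can be
multiplied, and they contain the coordinate rays; bounded convergence shows
that the two probabilities agree on them. *)
Lemma probability_rV_eq_bc (R : realType) k (mu nu : probability 'rV[R]_k R) :
  (forall f, bounded_continuous f -> \int[mu]_x f x = \int[nu]_x f x) ->
  forall A, measurable A -> mu A = nu A.
Proof.
move=> mn.
pose D : set_system 'rV[R]_k := [set A | exists h : nat -> 'rV[R]_k -> R,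
  [/\ forall m, bounded_continuous (h m), forall m x, 0 <= h m x <= 1 &
     forall x, h m x @[m --> \oo] --> (\1_A x : R)]].
have mD : D `<=` measurable.
  move=> A [h [ch _ hA]].
  have : measurable_fun setT (\1_A : 'rV[R]_k -> R).
    apply: (measurable_fun_cvg (h := h)) => [m|x _]; last exact: hA.
    by apply: continuous_measurable_rV; case: (ch m).
  move=> /(_ measurableT [set 1] (measurable_set1 _)); rewrite setTI.
  rewrite (_ : _ @^-1` _ = A)//; apply/seteqP; split => x /=.
    rewrite indicE; case: (boolP (x \in A)) => [/set_mem//|_ /eqP].
    by rewrite eq_sym oner_eq0.
  by move=> Ax; rewrite indicE mem_set.
apply: (@probability_rV_eq _ _ _ _ D) => //.
- move=> A B [h [ch h01 hA]] [g [cg g01 gB]].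
  exists (fun m x => h m x * g m x); split.
  + by move=> m; exact: bcM.
  + move=> m x; have /andP[h0 h1] := h01 m x; have /andP[g0 g1] := g01 m x.
    by rewrite mulr_ge0//= mulr_ile1.
  + by move=> x; rewrite indicI; apply: cvgM; [exact: hA|exact: gB].
- exists (fun _ _ => 1); split.
  + by move=> _; exact: bc_cst.
  + by move=> _ _; rewrite ler01 lexx.
  + by move=> x; rewrite indicT; exact: cvg_cst.
- move=> i a; exists (ray_fun i a); split.
  + exact: ray_fun_bc.
  + by move=> m x; rewrite ray_fun_ge0 ray_fun_le1.
  + exact: ray_fun_cvg.
- move=> A DA; have mA := mD _ DA; case: DA => h [ch h01 hA].
  rewrite -!mean_indic//; congr EFin.
  have cv (P : probability 'rV[R]_k R) :
      \int[P]_x h m x @[m --> \oo] --> \int[P]_x (\1_A x : R).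
    apply: (@mean_dominated _ _ _ _ _ _ 1) => //.
    + by move=> m; exact/bc_bm/ch.
    + exact: bm_indic.
    + by move=> m x; have /andP[h0 h1] := h01 m x; rewrite ger0_norm.
  have <- := cvg_lim (@Rhausdorff R) (cv mu).
  have <- := cvg_lim (@Rhausdorff R) (cv nu).
  rewrite (_ : (fun m => _) = fun m => \int[nu]_x h m x)//.
  by apply/funext => m; exact: mn.
Qed.

(** * Tight positive functionals are integrals *)

Section riesz.
Context {R : realType} {k : nat}.
Variable L : ('rV[R]_k -> R) -> R.
Local Notation bc := (@bounded_continuous R k).
Hypothesis LD : forall f g, bc f -> bc g -> L (fun x => f x + g x) = L f + L g.
Hypothesis LZ : forall c f, bc f -> L (fun x => c * f x) = c * L f.
Hypothesis Lge0 : forall f, bc f -> (forall x, 0 <= f x) -> 0 <= L f.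
Hypothesis L1 : L (fun=> 1) = 1.
Hypothesis Ltight : forall e : R, 0 < e -> exists2 K : set 'rV[R]_k, compact K &
  forall f, bc f -> (forall x, f x <= 1) -> (forall x, K x -> f x <= 0) ->
    L f <= e.

Let Lcst c : L (fun=> c) = c.
Proof.
rewrite (_ : (fun=> c) = fun x : 'rV[R]_k => c * 1); last first.
  by apply/funext => x; rewrite mulr1.
by rewrite LZ ?L1 ?mulr1//; exact: bc_cst.
Qed.

Let LB f g : bc f -> bc g -> L (fun x => f x - g x) = L f - L g.
Proof.
move=> bf bg; rewrite (_ : (fun _ => _) = fun x => f x + -1 * g x).
  by rewrite LD// ?LZ// ?mulN1r//; exact: bcZ.
by apply/funext => x; rewrite mulN1r.
Qed.

Let Lle f g : bc f -> bc g -> (forall x, f x <= g x) -> L f <= L g.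
Proof.
move=> bf bg fg; rewrite -subr_ge0 -LB//; apply: Lge0; first exact: bcB.
by move=> x; rewrite subr_ge0.
Qed.

Let Lsum (f : nat -> 'rV[R]_k -> R) n : (forall i, bc (f i)) ->
  bc (fun x => \sum_(i < n) f i x) /\
  L (fun x => \sum_(i < n) f i x) = \sum_(i < n) L (f i).
Proof.
move=> bf; elim: n => [|n [bn IHn]].
  rewrite big_ord0 (_ : (fun _ => _) = fun=> 0).
    by split; [exact: bc_cst|exact: Lcst].
  by apply/funext => x; rewrite big_ord0.
rewrite (_ : (fun x => _) = fun x => \sum_(i < n) f i x + f n x).
  by split; [exact: bcD|rewrite LD// big_ord_recr/= IHn].
by apply/funext => x; rewrite big_ord_recr.
Qed.

(** The increasing sequence [F] has a supremum at least 1 on [A], and [c] bounds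
the value of the functional along [F].  Sequences that increase to the bound
are preferred to series of functions because countable subadditivity then
needs a single diagonal sum instead of a rearranged double series. *)
Definition covering (A : set 'rV[R]_k) (F : nat -> 'rV[R]_k -> R) (c : R) :=
  [/\ forall m, bc (F m), forall m x, 0 <= F m x,
      forall x m n, (m <= n)%N -> F m x <= F n x,
      forall x, A x -> forall e, e < 1 -> exists m, e < F m x &
      forall m, L (F m) <= c].

Definition riesz_outer (A : set 'rV[R]_k) : \bar R :=
  ereal_inf [set c%:E | c in [set c | exists F, covering A F c]].

Local Notation outer := riesz_outer.

Lemma riesz_outer_le A F c : covering A F c -> (outer A <= c%:E)%E.
Proof. by move=> cov; apply: ereal_inf_lbound; exists c => //; exists F. Qed.

Lemma riesz_outer_ge0 A : (0 <= outer A)%E.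
Proof.
apply: le_ereal_inf_tmp => _ [c [F [bF F0 _ _ Fc]] <-].
by rewrite lee_fin (le_trans _ (Fc 0%N))// Lge0.
Qed.

Lemma riesz_outer_le1 A : (outer A <= 1)%E.
Proof.
apply: (@riesz_outer_le _ (fun _ _ => 1)); split => //.
- by move=> m; exact: bc_cst.
- by move=> m; rewrite Lcst.
Qed.

Lemma riesz_outer_fin A : outer A \is a fin_num.
Proof.
rewrite ge0_fin_numE ?riesz_outer_ge0//.
by rewrite (le_lt_trans (riesz_outer_le1 A))// ltry.
Qed.

Lemma riesz_outer0 : outer set0 = 0%E.
Proof.
apply/eqP; rewrite eq_le riesz_outer_ge0 andbT.
apply: (@riesz_outer_le _ (fun _ _ => 0)); split => //.
- by move=> m; exact: bc_cst.
- by move=> m; rewrite Lcst.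
Qed.

(** If [F i] covers [B i] at cost [c i], then the diagonal sums
[F 0 m + ... + F m m] increase in [m] and cover the union at cost
[c 0 + c 1 + ...]. *)
Lemma riesz_outer_subadditive A (B : (set 'rV[R]_k)^nat) :
  subset_sigma_subadditive outer A B.
Proof.
move=> AB; have [->|] := eqVneq (\sum_(n <oo) outer (B n))%E +oo%E.
  by rewrite leey.
rewrite -ltey => Soo; apply/lee_addgt0Pr => e e0.
have Sfin : (\sum_(n <oo) outer (B n))%E \is a fin_num.
  by rewrite ge0_fin_numE// nneseries_ge0// => n _ _; exact: riesz_outer_ge0.
have /(_ _)/cid-/all_sig[c] : forall n, exists c : R,
    (exists F, covering (B n) F c) /\
    (c%:E <= outer (B n) + (e / (2 ^ n.+1)%:R)%:E)%E.
  move=> n; have en : 0 < e / (2 ^ n.+1)%:R.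
    by rewrite divr_gt0// ltr0n expn_gt0.
  have [_ [c [F cF] <-] cn] := lb_ereal_inf_adherent en (riesz_outer_fin (B n)).
  by exists c; split; [exists F|exact: ltW].
move=> /all_and2[/(_ _)/cid-/all_sig[F cF] cB].
rewrite -(fineK Sfin) -EFinD.
apply: (@riesz_outer_le _ (fun m x => \sum_(i < m.+1) F i m x)); split.
- move=> m; apply: (Lsum (f := fun i => F i m) _ _).1 => i.
  by have [] := cF i.
- by move=> m x; apply: sumr_ge0 => i _; have [_ + _ _ _] := cF i; exact.
- move=> x m n mn; apply: (@le_trans _ _ (\sum_(i < m.+1) F i n x)).
    by apply: ler_sum => i _; have [_ _ + _ _] := cF i; exact.
  rewrite (big_ord_widen n.+1 (fun i => F i n x))// big_mkcond/=.
  by apply: ler_sum => i _; case: ifP => // _; have [_ + _ _ _] := cF i; exact.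
- move=> x /AB[i _ Bix] r r1; have [_ F0 Fnd /(_ x Bix r r1)[m rm] _] := cF i.
  exists (maxn i m); rewrite (lt_le_trans rm)//.
  rewrite (le_trans (Fnd x _ _ (leq_maxr i m)))//.
  have im : (i < (maxn i m).+1)%N by rewrite ltnS leq_maxl.
  rewrite (bigD1 (Ordinal im))//= lerDl sumr_ge0// => j _.
  by have [_ + _ _ _] := cF j; exact.
- move=> m; have bF i : bc (F i m) by have [+ _ _ _ _] := cF i; exact.
  have [_ ->] := Lsum (f := fun i => F i m) m.+1 bF.
  rewrite -lee_fin EFinD fineK//.
  apply: le_trans (epsilon_trick _ (fun n => riesz_outer_ge0 (B n)) (ltW e0)).
  apply: le_trans (nneseries_lim_ge m.+1 _); last first.
    by move=> n _ _; rewrite adde_ge0 ?riesz_outer_ge0// lee_fin divr_ge0// ltW.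
  rewrite -sumEFin big_mkord; apply: lee_sum => i _.
  by apply: le_trans (cB i); rewrite lee_fin; have [_ _ _ _ +] := cF i; exact.
Qed.

HB.instance Definition _ := isSubsetOuterMeasure.Build R 'rV[R]_k riesz_outer
  riesz_outer0 riesz_outer_ge0 riesz_outer_subadditive.

(** Let [F] cover [X] at cost [c], and let [h j] increase to the indicator of
the ray [G].  The sequence [F m * h m] covers the part of [X] in [G], and for
each fixed [j] the sequence [F m * (1 - h j)] covers the part of [X] outside
[G], since [h j] vanishes there.  The values of [F m * (1 - h j)] and of
[F j * h j] sum to at most [c], whence the cost [c - L (F j * h j)] of the
second cover. *)
Lemma caratheodory_ray (i : 'I_k) (a : R) :
  riesz_outer.-caratheodory [set x : 'rV[R]_k | a < x ord0 i].
Proof.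
set G := [set _ | _]; apply: le_caratheodory_measurable => X.
apply: le_ereal_inf_tmp => _ [c [F [bF F0 Fnd FX Fc]] <-].
pose h := ray_fun i a.
have bh j : bc (h j) by exact: ray_fun_bc.
have Lh j : (outer (X `&` ~` G) <= (c - L (fun x => F j x * h j x)%R)%:E)%E.
  apply: (@riesz_outer_le _ (fun m x => F m x * (1 - h j x))); split.
  - by move=> m; apply: bcM => //; apply: bcB => //; exact: bc_cst.
  - by move=> m x; rewrite mulr_ge0// subr_ge0 ray_fun_le1.
  - by move=> x m n mn; rewrite ler_wpM2r ?Fnd// subr_ge0 ray_fun_le1.
  - move=> x [Xx Gx] e /(FX x Xx)[m em]; exists m.
    by rewrite /h ray_fun_out ?subr0 ?mulr1// leNgt; exact/negP.
  - move=> m; rewrite lerBrDr.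
    apply: le_trans (Fc (maxn m j)).
    apply: (@le_trans _ _ (L (fun x => F (maxn m j) x * (1 - h j x)) +
                           L (fun x => F (maxn m j) x * h j x))).
      apply: lerD; apply: Lle;
        try by apply: bcM => //; apply: bcB => //; exact: bc_cst.
      + by move=> x; rewrite ler_wpM2r ?Fnd ?leq_maxl// subr_ge0 ray_fun_le1.
      + by move=> x; rewrite ler_wpM2r ?Fnd ?leq_maxr// ray_fun_ge0.
    rewrite -LD.
    + apply: Lle => //.
      * apply: bcD; apply: bcM => //; apply: bcB => //; exact: bc_cst.
      * by move=> x; rewrite -mulrDr subrK mulr1.
    + by apply: bcM => //; apply: bcB => //; exact: bc_cst.
    + exact: bcM.
suff : (outer (X `&` G) <= (c - fine (outer (X `&` ~` G)))%:E)%E.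
  by rewrite EFinB fineK ?riesz_outer_fin// leeBrDr ?riesz_outer_fin.
apply: (@riesz_outer_le _ (fun m x => F m x * h m x)); split.
- by move=> m; exact: bcM.
- by move=> m x; rewrite mulr_ge0// ray_fun_ge0.
- by move=> x m n mn; rewrite ler_pM ?Fnd ?ray_fun_ge0// ray_fun_nd.
- move=> x [Xx Gx] e /(FX x Xx)[m em].
  have [n _ hn] := ray_fun_in Gx.
  exists (maxn m n); rewrite /h hn/= ?leq_maxr// mulr1.
  by rewrite (lt_le_trans em)// Fnd// leq_maxl.
- move=> m; rewrite lerBrDr -lerBrDl -lee_fin fineK; first exact: Lh.
  exact: riesz_outer_fin.
Qed.

Lemma caratheodory_rV : measurable `<=` riesz_outer.-caratheodory.
Proof.
apply: rV_measurable_sub; last exact: caratheodory_ray.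
split.
- exact: caratheodory_measurable_set0.
- by move=> A mA; rewrite setTD; exact: caratheodory_measurable_setC.
- by move=> F mF; exact: caratheodory_measurable_bigcup.
Qed.

(** Tightness keeps mass from being lost: a cover of the whole space is, by
compactness, uniformly at least [1 - e / 2] on the compact set [K] from some
index on, and outside [K] the functional sees at most [e / 2]. *)
Lemma riesz_outerT : outer setT = 1%E.
Proof.
apply/eqP; rewrite eq_le riesz_outer_le1/=.
apply: le_ereal_inf_tmp => _ [c [F [bF F0 Fnd FX Fc]] <-].
rewrite lee_fin; apply/ler_addgt0Pr => e e0.
have e20 : 0 < e / 2 by rewrite divr_gt0.
have [K cK LK] := Ltight e20.
have : \forall m \near \oo, K `<=` (fun x => 1 - e / 2 < F m x).
  apply: ((compact_near_coveringP K).1 cK) => x Kx.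
  have [|m em] := FX x I (1 - e / 2); first by rewrite ltrBlDr ltrDl.
  have [cF _] := bF m.
  exists ([set y | 1 - e / 2 < F m y], [set n | (m <= n)%N]) => /=.
    split; last exact: nbhs_infty_ge.
    exact: (cvgr_gt (F m x) (cF x) _ em).
  by move=> [y n] /= [h mn]; rewrite (lt_le_trans h)// Fnd.
move=> [m _ /(_ m (leqnn m)) mK].
have := LK (fun x => (1 - e / 2) - F m x) _ _ _.
rewrite LB//; last exact: bc_cst.
rewrite Lcst => h.
suff : 1 - e / 2 - L (F m) <= e / 2 by have := Fc m; lra.
apply: h.
- by apply: bcB => //; exact: bc_cst.
- by move=> x; have := F0 m x; lra.
- by move=> x /mK; lra.
Qed.

Let nu (A : set 'rV[R]_k) := outer A.

Let nu_sigma_additive : semi_sigma_additive nu.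
Proof.
move=> F mF tF mUF.
have := @caratheodory_measure_sigma_additive R 'rV[R]_k riesz_outer.
apply => //.
- by move=> n; apply: caratheodory_rV.
- exact: caratheodory_rV.
Qed.

HB.instance Definition _ := isMeasure.Build _ 'rV[R]_k R nu riesz_outer0
  riesz_outer_ge0 nu_sigma_additive.

HB.instance Definition _ := Measure_isProbability.Build _ _ _ nu riesz_outerT.

(* Layer cake: cut [f] into the slices [s i] between the levels i/N and
   (i+1)/N.  Since [N * s i] is 1 where [f] exceeds the upper level of the
   slice, it is a cover of that set. *)
Let nu_le f : bc f -> (forall x, 0 <= f x <= 1) -> \int[nu]_x f x <= L f.
Proof.
move=> bf f01; apply/ler_addgt0Pr => e e0.
have [n _ /(_ n (leqnn n)) /= ne] := near_infty_natSinv_lt (PosNum e0).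
set N : R := n.+1%:R.
have N0 : 0 < N by rewrite ltr0n.
pose s (i : nat) x := Num.min (f x) (i.+1%:R / N) - Num.min (f x) (i%:R / N).
have bs i : bc (s i).
  by apply: bcB; apply: bc_min => //; exact: bc_cst.
have iN i : i%:R / N <= i.+1%:R / N by rewrite ler_pM2r ?invr_gt0// ler_nat.
have s0 i x : 0 <= s i x.
  by rewrite /s subr_ge0 le_min ge_min lexx/= ge_min iN orbT.
have iN1 i : i.+1%:R / N = i%:R / N + N^-1 by rewrite -natr1 mulrDl mul1r.
have s1 i x : s i x <= N^-1.
  have slice (t u v : R) : 0 < v -> Num.min t (u + v) - Num.min t u <= v.
    by move=> v0; case: (leP t (u + v)); case: (leP t u); lra.
  by rewrite /s iN1 slice// invr_gt0.
have sumf x : f x = \sum_(i < n.+1) s i x.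
  rewrite -(big_mkord xpredT (fun i => s i x)).
  rewrite (telescope_sumr (fun i => Num.min (f x) (i%:R / N)))//.
  rewrite mul0r divff ?gt_eqF//.
  have /andP[f0 f1] := f01 x.
  by rewrite (min_idPl f1) (min_idPr f0) subr0.
pose A i := [set x | i.+1%:R / N < f x].
have mA i : measurable (A i).
  have := continuous_measurable_rV bf.1.
  move=> /(_ measurableT `]i.+1%:R / N, +oo[%classic (measurable_itv _)).
  rewrite setTI; congr (measurable _).
  by apply/seteqP; split => x /=; rewrite in_itv/= andbT.
have nuA i : \int[nu]_x (\1_(A i) x : R) <= N * L (s i).
  rewrite -lee_fin mean_indic//.
  apply: (@riesz_outer_le _ (fun _ x => N * s i x)); split.
  - by move=> _; exact: bcZ.
  - by move=> _ x; rewrite mulr_ge0// ltW.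
  - by move=> *.
  - move=> x Aix r r1; exists 0%N.
    rewrite /s (min_idPr (ltW Aix)) (min_idPr (le_trans (iN i) (ltW Aix))).
    by rewrite iN1 addrC addKr divff// gt_eqF.
  - by move=> _; rewrite LZ.
pose g x := N^-1 + \sum_(i < n) N^-1 * \1_(A i) x.
have bA i : bounded_measurable (fun x => N^-1 * \1_(A i) x : R).
  by apply: bmZ; exact: bm_indic.
have [bS ES] := mean_sum nu (index_enum 'I_n) (fun i : 'I_n => bA i).
have fg x : f x <= g x.
  rewrite sumf big_ord_recl/= /g lerD// ler_sum// => i _ /=.
  rewrite indicE; case: (boolP (x \in A i)) => [_|]; first by rewrite mulr1.
  rewrite notin_setE /A/= => /negP; rewrite -leNgt mulr0 => fi.
  rewrite /s/= /bump/= !add1n (min_idPl fi).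
  by rewrite (min_idPl (le_trans fi (iN _))) subrr.
apply: (@le_trans _ _ (\int[nu]_x g x)).
  apply: mean_le => //; first exact: bc_bm.
  by apply: bmD => //; exact: bm_cst.
rewrite meanD//; last exact: bm_cst.
rewrite mean_cst ES addrC; apply: lerD; last exact: ltW.
have [bS' ES'] := Lsum n.+1 bs.
rewrite [f](_ : _ = fun x => \sum_(i < n.+1) s i x); last exact/funext.
rewrite ES' big_ord_recr/= -[leLHS]addr0 lerD//; last exact: Lge0.
apply: ler_sum => i _; rewrite meanZ; last exact: bm_indic.
by rewrite ler_pdivrMl.
Qed.

(* Rescale [f] affinely to values in [0, 1]. *)
Let nu_le_bc f : bc f -> \int[nu]_x f x <= L f.
Proof.
move=> bf; have [cf [B0 fB0]] := bf; pose B := Num.max 1 B0.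
have B0' : 0 < B by rewrite lt_max ltr01.
have fB x : `|f x| <= B by rewrite le_max fB0 orbT.
pose c := (2 * B)^-1.
have c0 : 0 < c by rewrite invr_gt0 mulr_gt0.
have := @nu_le (fun x => c * f x + c * B) _ _.
rewrite meanD//; [|by apply/bc_bm; exact: bcZ|exact: bm_cst].
rewrite meanZ//; last exact: bc_bm.
rewrite mean_cst LD//; [|exact: bcZ|exact: bc_cst].
rewrite LZ// Lcst lerD2r ler_pM2l//; apply.
  by apply: bcD; [exact: bcZ|exact: bc_cst].
move=> x; rewrite -mulrDr mulr_ge0/= ?(ltW c0)//; last first.
  by have := fB x; rewrite ler_norml => /andP[]; lra.
rewrite /c mulrC ler_pdivrMr ?mulr_gt0// mul1r.
by have := fB x; rewrite ler_norml => /andP[]; lra.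
Qed.

(** The upper bound of the integral by the functional, applied to a function and
to its opposite, gives equality. *)
Theorem riesz_probability : exists mu : probability 'rV[R]_k R,
  forall f, bc f -> \int[mu]_x f x = L f.
Proof.
exists nu => f bf; apply/eqP; rewrite eq_le nu_le_bc//=.
have bNf : bc (fun x => -1 * f x) by exact: bcZ.
have := nu_le_bc bNf; rewrite meanZ ?LZ//; last exact: bc_bm.
by rewrite !mulN1r lerN2.
Qed.

End riesz.

(** * Ultrafilter limits of tight sequences *)

(** Otherwise some neighbourhood of the limit is avoided infinitely often, and
an ultrafilter containing the set of indices where this happens contradicts the
hypothesis. *)
Lemma cvg_ultra (T : topologicalType) (u : nat -> T) (l : T) :
  (forall U : set_system nat, UltraFilter U ->
     (forall S, (\forall n \near \oo, S n) -> U S) -> u @ U --> l) ->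
  u @ \oo --> l.
Proof.
move=> h A Al; apply: contrapT => nA.
have pf : ProperFilter (within (fun n => ~ A (u n)) \oo).
  split; last exact: within_filter.
  move=> wn; apply: nA; move: wn; rewrite /within /=.
  by apply: filterS => n An; apply: contrapT => /An.
have [U [UU sU]] := ultraFilterLemma pf.
have UA : U [set n | A (u n)].
  apply: (h U UU _ _ Al) => S nS; apply: sU.
  by apply: filterS nS.
have UnA : U [set n | ~ A (u n)] by apply: sU; apply: nearW.
have [UF _] := UU.
have [n [An nAn]] := filter_ex (filterI UA UnA).
exact: nAn.
Qed.

(** The image of an ultrafilter in a compact interval has a cluster point, and
an ultrafilter converges to its cluster points. *)
Lemma ultra_bounded_cvg (R : realType) (u : nat -> R) (B : R)
    (U : set_system nat) :
  UltraFilter U -> (forall n, `|u n| <= B) -> cvg (u @ U).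
Proof.
move=> UU uB; have pU := ultra_proper.
have cB : compact `[- B, B]%classic := @segment_compact R _ _.
have /cB[l [_ cl]] : (u @ U) `[- B, B]%classic.
  by apply: (@filterE _ U) => n /=; rewrite in_itv/= -ler_norml.
apply/cvg_ex; exists l => A Al.
have [//|UA] := in_ultra_setVsetC (u @^-1` A) UU.
have [x [nAx Ax]] := cl (~` A) A UA Al.
by case: nAx.
Qed.

(** Prokhorov's theorem in ultrafilter form: the limit of the means is a
positive linear functional, and it inherits tightness. *)
Lemma tight_ultra_limit (R : realType) k (mu : nat -> probability 'rV[R]_k R)
    (U : set_system nat) : UltraFilter U ->
  (forall e : R, 0 < e -> exists2 A : set 'rV[R]_k, compact A /\ measurable A &
    forall n, fine (mu n (~` A)) <= e) ->
  exists nu : probability 'rV[R]_k R, forall f, bounded_continuous f ->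
    \int[mu n]_x f x @[n --> U] --> \int[nu]_x f x.
Proof.
move=> UU tmu; have pU := @ultra_proper _ _ UU.
pose L (f : 'rV[R]_k -> R) := lim (\int[mu n]_x f x @[n --> U]).
have Lcvg f : bounded_continuous f -> \int[mu n]_x f x @[n --> U] --> L f.
  move=> bf; have [_ [B fB]] := bf.
  apply: (@ultra_bounded_cvg _ _ B) => // n.
  by apply: mean_le_cst => //; exact: bc_bm.
have Leq (f : 'rV[R]_k -> R) (l : R) :
    \int[mu n]_x f x @[n --> U] --> l -> L f = l.
  by move=> fl; exact: (cvg_lim (@Rhausdorff R) fl).
have [|||||nu hnu] := @riesz_probability R k L.
- move=> f g bf bg; apply: Leq.
  rewrite (_ : (fun n => _) = (fun n => \int[mu n]_x f x + \int[mu n]_x g x)).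
    by apply: (@cvgD _ R^o); exact: Lcvg.
  by apply/funext => n; rewrite meanD//; exact: bc_bm.
- move=> c f bf; apply: Leq.
  rewrite (_ : (fun n => _) = (fun n => c * \int[mu n]_x f x)).
    by apply: (@cvgMl_tmp R); exact: Lcvg.
  by apply/funext => n; rewrite meanZ//; exact: bc_bm.
- move=> f bf f0; apply: limr_ge.
    by apply/cvg_ex; exists (L f); exact: Lcvg.
  by apply: nearW => n; exact: Rintegral_ge0.
- apply: Leq; rewrite (_ : (fun n => _) = fun=> 1); first exact: cvg_cst.
  by apply/funext => n; rewrite mean_cst.
- move=> e e0; have [A [cA mA] hA] := tmu _ e0; exists A => // f bf f1 fA.
  apply: limr_le; first by apply/cvg_ex; exists (L f); exact: Lcvg.
  apply: nearW => n; apply: le_trans (hA n).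
  have mAC := measurableC mA.
  have := mean_indic (mu n) mAC => /(congr1 fine) /= <-.
  apply: mean_le; [exact: bc_bm|exact: bm_indic|move=> x].
  have [Ax|Ax] := pselect (A x).
    by rewrite indicE memNset ?fA//=; apply.
  by rewrite indicE mem_set.
by exists nu => f bf; rewrite hnu//; exact: Lcvg.
Qed.

(** * Couplings *)

(** A copy of [K x] that carries the structure of a probability. *)
Definition kprob d d' (T : measurableType d) (T' : measurableType d')
  (R : realType) (K : R.-pker T ~> T') (x : T) : set T' -> \bar R := K x.

Section kprob.
Context d d' (T : measurableType d) (T' : measurableType d') (R : realType).
Variables (K : R.-pker T ~> T') (x : T).

HB.instance Definition _ := Measure.on (kprob K x).

HB.instance Definition _ := Measure_isProbability.Build _ _ _
  (kprob K x) (@prob_kernel _ _ _ _ _ K x).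

End kprob.

Section coupling.
Context {R : realType} (N : R -> R) (hN : is_norm (N : R^o -> R)).

Let NE t : N t = `|t| * N 1.
Proof.
case: hN => _ NZ _; have := NZ t 1; rewrite /GRing.scale/= => <-.
by rewrite mulr1.
Qed.

Let N1_gt0 : 0 < N 1.
Proof.
case: hN => N0 NZ ND; have N00 : N 0 = 0 by rewrite NE normr0 mul0r.
have := ND 1 (-1); rewrite subrr N00 (NE (-1)) normrN1 mul1r => h.
rewrite lt_neqAle; apply/andP; split; last by lra.
by apply/negP => /eqP/esym/N0/eqP; rewrite oner_eq0.
Qed.

(** The constant of Markov's inequality for the coupling cost: two points at
distance at least [eta] cost at least the inverse of [cost_factor eta]. *)
Definition cost_factor (eta : R) := (Num.min (eta * N 1) 1)^-1.

Lemma cost_factor_gt0 eta : 0 < eta -> 0 < cost_factor eta.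
Proof. by move=> e0; rewrite invr_gt0 lt_min ltr01 mulr_gt0. Qed.

(** Take a coupling of cost less than [c].  The integrands are within [eps] of
each other when the second point is in [S] and the points are [eta]-close;
otherwise they differ by at most [2 * B], and this has small probability by
Markov's inequality.  Two different integrands are allowed so that the same
bound handles a change of the test function along with the change of the law. *)
Lemma coupling_bound (m1 m2 : probability R R) (G1 G2 : R -> R) (S : set R)
    (B eta eps c : R) :
  bounded_measurable G1 -> bounded_measurable G2 ->
  (forall z, `|G1 z| <= B) -> (forall z, `|G2 z| <= B) ->
  measurable S -> 0 < eta -> 0 <= eps ->
  (forall z z', S z -> `|z' - z| < eta -> `|G1 z' - G2 z| <= eps) ->
  (dist_d N m1 m2 < c%:E)%E ->
  `|\int[m1]_z G1 z - \int[m2]_z G2 z| <=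
    eps + 2 * B * fine (m2 (~` S)) + 2 * B * cost_factor eta * c.
Proof.
move=> b1 b2 B1 B2 mS eta0 eps0 close.
move=> /ereal_inf_lt[_ [d [T [Q [X [Y [hX hY ->]]]]]]] Qc.
have B0 : 0 <= B by rewrite (le_trans _ (B1 0)).
have -> : \int[m1]_z G1 z = \int[Q]_w G1 (X w).
  rewrite -(mean_distribution X b1) /Rintegral; congr fine.
  by apply: eq_measure_integral => A mA _; exact/esym/hX.
have -> : \int[m2]_z G2 z = \int[Q]_w G2 (Y w).
  rewrite -(mean_distribution Y b2) /Rintegral; congr fine.
  by apply: eq_measure_integral => A mA _; exact/esym/hY.
have mX : measurable_fun setT X by exact: measurable_funPT.
have mY : measurable_fun setT Y by exact: measurable_funPT.
have bX : bounded_measurable (fun w => G1 (X w)) by apply: (bm_comp mX b1).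
have bY : bounded_measurable (fun w => G2 (Y w)) by apply: (bm_comp mY b2).
pose cst w := Num.min (N (X w - Y w)) 1.
have cst0 w : 0 <= cst w.
  by rewrite /cst le_min ler01 andbT NE mulr_ge0// ltW.
have bcst : bounded_measurable cst.
  split; last by exists 1 => w; rewrite ger0_norm// ge_min lexx orbT.
  rewrite /cst (_ : (fun _ => _) =
    (fun w => `|X w - Y w| * N 1) \min (fun=> 1)).
    apply: measurable_minr => //; apply: measurable_funM => //.
    by apply: measurableT_comp => //; exact: measurable_funB.
  by apply/funext => w; rewrite NE.
have mSY : measurable (Y @^-1` ~` S).
  by rewrite -[X in measurable X]setTI; apply: mY => //; exact: measurableC.
have bI := bm_indic R mSY.
have {}Qc : \int[Q]_w cst w < c.
  by move: Qc; rewrite unlock -lte_fin -bm_integralE.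
have -> : fine (m2 (~` S)) = \int[Q]_w (\1_(Y @^-1` ~` S) w : R).
  have := mean_indic Q mSY => /(congr1 fine) /= ->.
  by rewrite -hY//; exact: measurableC.
rewrite -meanB//; apply: le_trans (mean_norm _ (bmB bX bY)) _.
pose K := 2 * B * cost_factor eta.
have K0 : 0 <= K by rewrite !mulr_ge0// ltW// cost_factor_gt0.
apply: (@le_trans _ _
  (\int[Q]_w (eps + 2 * B * \1_(Y @^-1` ~` S) w + K * cst w))).
  apply: mean_le.
  - by apply: bm_norm; exact: bmB.
  - by apply: bmD; [apply: bmD; [exact: bm_cst|exact: bmZ]|exact: bmZ].
  move=> w.
  have G2B : `|G1 (X w) - G2 (Y w)| <= 2 * B.
    rewrite (le_trans (ler_normB _ _))//.
    by have := B1 (X w); have := B2 (Y w); lra.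
  have [YS|YS] := pselect (S (Y w)); last first.
    rewrite indicE mem_set//= mulr1 (le_trans G2B)//.
    by have := mulr_ge0 K0 (cst0 w); lra.
  rewrite indicE memNset/=; last by apply.
  rewrite mulr0 addr0; have [h|h] := ltP `|X w - Y w| eta.
    by rewrite (le_trans (close _ _ YS h))// lerDl mulr_ge0.
  rewrite (le_trans G2B)// -[leLHS]add0r lerD// -[leLHS]mulr1 /K -[leRHS]mulrA.
  rewrite ler_wpM2l ?mulr_ge0//.
  rewrite /cost_factor mulrC ler_pdivlMr ?mul1r; last first.
    by rewrite lt_min ltr01 mulr_gt0.
  rewrite /cst le_min !ge_min lexx orbT andbT (NE (X w - Y w)).
  by apply/orP; left; rewrite ler_wpM2r// ltW.
rewrite meanD; [|by apply: bmD; [exact: bm_cst|exact: bmZ]|exact: bmZ].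
rewrite meanD; [|exact: bm_cst|exact: bmZ].
rewrite mean_cst !meanZ// lerD2l.
by rewrite -/K ler_wpM2l// ltW.
Qed.

(** Tails are transported by the distance; this gives tightness of the kernel
near a point from its tightness at that point. *)
Lemma coupling_tail (m1 m2 : probability R R) (S S1 : set R) (c : R) :
  measurable S -> measurable S1 ->
  (forall z z', S z -> `|z' - z| < 1 -> S1 z') ->
  (dist_d N m1 m2 < c%:E)%E ->
  fine (m1 (~` S1)) <= 2 * fine (m2 (~` S)) + 2 * cost_factor 1 * c.
Proof.
move=> mS mS1 SS1 dc.
have mS1C := measurableC mS1.
have := @coupling_bound m1 m2 (\1_(~` S1)) (fun=> 0) S 1 1 0 c.
rewrite mean_cst subr0 add0r !mulr1.
have -> : \int[m1]_z (\1_(~` S1) z : R) = fine (m1 (~` S1)).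
  by have := mean_indic m1 mS1C => /(congr1 fine).
move=> h; apply: le_trans (ler_norm _) _; apply: h => //.
- exact: bm_indic.
- exact: bm_cst.
- by move=> z; rewrite indicE; case: (_ \in _); rewrite ?normr1 ?normr0.
- by move=> z; rewrite normr0.
- move=> z z' /SS1 /[apply] S1z'; rewrite indicE memNset ?subrr ?normr0//=.
Qed.

End coupling.

Lemma dist_d_lt_sym {R : realType} (N : R -> R) (hN : is_norm (N : R^o -> R))
    (m1 m2 : {measure set R -> \bar R}) (c : \bar R) :
  (dist_d N m1 m2 < c)%E -> (dist_d N m2 m1 < c)%E.
Proof.
move=> /ereal_inf_lt[_ [d [T [Q [X [Y [hX hY ->]]]]]] Qc].
apply: le_lt_trans Qc; apply: ereal_inf_lbound.
exists d, T, Q, Y, X; split => //; congr ('E_Q[_])%E; apply/funext => w.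
congr (Num.min _ _); case: hN => _ NZ _.
have := NZ (-1) (Y w - X w); rewrite normrN1 mul1r => <-.
by rewrite /GRing.scale/= mulN1r opprB.
Qed.

(** * Appending a value drawn from a kernel *)

Section snoc.
Context {R : realType} {k : nat}.

Definition snoc (x : 'rV[R]_k) (z : R) : 'rV[R]_k.+1 :=
  \row_(i < k.+1) (if unlift ord_max i is Some j then x ord0 j else z).

Definition init_rV (v : 'rV[R]_k.+1) : 'rV[R]_k :=
  \row_j v ord0 (lift ord_max j).

Lemma snoc_lift x z j : snoc x z ord0 (lift ord_max j) = x ord0 j.
Proof. by rewrite mxE liftK. Qed.

Lemma snoc_max x z : snoc x z ord0 ord_max = z.
Proof. by rewrite mxE unlift_none. Qed.

Lemma init_snoc x z : init_rV (snoc x z) = x.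
Proof. by apply/rowP => j; rewrite mxE snoc_lift. Qed.

Lemma measurable_snoc x : measurable_fun [set: R] (snoc x).
Proof.
apply: measurable_fun_rV => i; under eq_fun do rewrite mxE.
by case: unliftP => [j|] _; [exact: measurable_cst|exact: measurable_id].
Qed.

HB.instance Definition _ x :=
  isMeasurableFun.Build _ _ _ _ (snoc x) (measurable_snoc x).

Lemma measurable_snoc2 d (T : measurableType d)
    (f : T -> 'rV[R]_k) (g : T -> R) :
  measurable_fun setT f -> measurable_fun setT g ->
  measurable_fun setT (fun t => snoc (f t) (g t)).
Proof.
move=> mf mg; apply: measurable_fun_rV => i; under eq_fun do rewrite mxE.
case: unliftP => [j|] _; last exact: mg.
exact: (measurableT_comp (measurable_coord j) mf).
Qed.

Lemma bm_snoc (f : 'rV[R]_k.+1 -> R) x :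
  bounded_measurable f -> bounded_measurable (fun z => f (snoc x z)).
Proof. by move=> bf; apply: (bm_comp (measurable_snoc x) bf). Qed.

Lemma measurable_init : measurable_fun setT init_rV.
Proof.
apply: measurable_fun_rV => i; under eq_fun do rewrite mxE.
exact: measurable_coord.
Qed.

End snoc.

(** [mu] is the law of the past, and [K (pi x)] the conditional law of the next
value after the past [x]; [semidirect] is the joint law.  It is a composition
of kernels starting from a one-point space. *)
Section semidirect.
Context {R : realType} {k p : nat} (pi : {mfun 'rV[R]_k >-> 'rV[R]_p}).
Variables (mu : probability 'rV[R]_k R) (K : R.-pker 'rV[R]_p ~> R).

Let kconst (_ : unit) : {measure set 'rV[R]_k -> \bar R} := mu.

Let measurable_kconst U :
  measurable U -> measurable_fun [set: unit] (kconst ^~ U).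
Proof. by move=> mU; exact: measurable_cst. Qed.

HB.instance Definition _ := isKernel.Build _ _ _ _ _ kconst measurable_kconst.

Let kconst_prob t : kconst t setT = 1%E.
Proof. exact: probability_setT. Qed.

HB.instance Definition _ :=
  Kernel_isProbability.Build _ _ _ _ _ kconst kconst_prob.

Let kpi (tx : unit * 'rV[R]_k) : {measure set R -> \bar R} := K (pi tx.2).

Let measurable_kpi U : measurable U -> measurable_fun setT (kpi ^~ U).
Proof.
move=> mU; apply: (measurableT_comp (measurable_kernel K _ mU)).
by apply: measurableT_comp => //; exact: measurable_funPT.
Qed.

HB.instance Definition _ := isKernel.Build _ _ _ _ _ kpi measurable_kpi.

Let kpi_prob t : kpi t setT = 1%E.
Proof. exact: prob_kernel. Qed.

HB.instance Definition _ := Kernel_isProbability.Build _ _ _ _ _ kpi kpi_prob.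

Let ksnoc (tx : unit * 'rV[R]_k) : {measure set 'rV[R]_k.+1 -> \bar R} :=
  distribution (kprob K (pi tx.2)) (snoc tx.2).

Let measurable_ksnoc U : measurable U -> measurable_fun setT (ksnoc ^~ U).
Proof.
move=> mU.
pose A := [set txz : (unit * 'rV[R]_k) * R | U (snoc txz.1.2 txz.2)].
have mA : measurable A.
  have := @measurable_snoc2 _ _ _ ((unit * 'rV[R]_k) * R)%type
    (fun t => t.1.2) snd.
  move=> /(_ _ _ measurableT U mU); rewrite setTI; apply => //.
  exact: (measurableT_comp measurable_snd measurable_fst).
have := @measurable_fun_xsection_finite_kernel _ _ _ _ _ kpi A (mem_set mA).
congr (measurable_fun _ _); apply/funext => tx /=; congr (K _ _).
by apply/seteqP; split => z /=; rewrite /xsection/= inE.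
Qed.

HB.instance Definition _ := isKernel.Build _ _ _ _ _ ksnoc measurable_ksnoc.

Let ksnoc_prob t : ksnoc t setT = 1%E.
Proof. exact: probability_setT. Qed.

HB.instance Definition _ :=
  Kernel_isProbability.Build _ _ _ _ _ ksnoc ksnoc_prob.

Definition semidirect (A : set 'rV[R]_k.+1) : \bar R := kcomp kconst ksnoc tt A.

HB.instance Definition _ := Measure.copy semidirect (kcomp kconst ksnoc tt).

Let semidirectT : semidirect setT = 1%E.
Proof.
rewrite /semidirect /kcomp (eq_integral (fun=> 1%E)); last first.
  by move=> x _; exact: ksnoc_prob.
by rewrite integral_cst//= mul1e; exact: kconst_prob.
Qed.

HB.instance Definition _ :=
  Measure_isProbability.Build _ _ _ semidirect semidirectT.

Lemma semidirectE A :
  semidirect A = (\int[mu]_x K (pi x) [set z | A (snoc x z)])%E.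
Proof. by []. Qed.

(** The conditional mean of [f] given the past [x]. *)
Definition kmean (f : 'rV[R]_k.+1 -> R) (x : 'rV[R]_k) : R :=
  \int[kprob K (pi x)]_z f (snoc x z).

Let ge0_measurable_kmean f : bounded_measurable f -> (forall v, 0 <= f v) ->
  measurable_fun setT (kmean f).
Proof.
move=> bf f0; apply/measurable_EFinP.
have mf := bf.1.
have := @measurable_fun_integral_finite_kernel _ _ _ _ _
  (fun xz : (unit * 'rV[R]_k) * R => (f (snoc xz.1.2 xz.2))%:E) kpi _ _.
have mff : measurable_fun setT
    (fun xz : (unit * 'rV[R]_k) * R => (f (snoc xz.1.2 xz.2))%:E).
  apply/measurable_EFinP; apply: (measurableT_comp mf).
  apply: measurable_snoc2 => //.
  exact: (measurableT_comp measurable_snd measurable_fst).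
move=> /(_ (fun _ => _) mff) => h.
have m2 : measurable_fun setT (fun x : 'rV[R]_k => (tt, x)).
  apply/measurable_fun_pairP.
  by split; [exact: measurable_cst|exact: measurable_id].
have := measurableT_comp (h _) m2.
rewrite (_ : _ \o _ = EFin \o kmean f).
  by apply; move=> t; rewrite lee_fin.
apply/funext => x /=; rewrite /kmean -bm_integralE//; exact: bm_snoc.
Qed.

Lemma bm_kmean f : bounded_measurable f -> bounded_measurable (kmean f).
Proof.
move=> bf; have [mf [B fB]] := bf; split; last first.
  by exists B => x; apply: mean_le_cst => //; exact: bm_snoc.
have -> : kmean f = fun x => kmean (fun v => f v + B) x - B.
  apply/funext => x; rewrite /kmean meanD ?mean_cst ?addrK//.
  - exact: bm_snoc.
  - exact: bm_cst.
apply: measurable_funB => //; apply: ge0_measurable_kmean.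
  by apply: bmD => //; exact: bm_cst.
by move=> v; have := fB v; rewrite ler_norml => /andP[]; lra.
Qed.

Lemma mean_semidirect f : bounded_measurable f ->
  \int[semidirect]_v f v = \int[mu]_x kmean f x.
Proof.
move=> bf; have [mf [B fB]] := bf.
suff ge0 g : bounded_measurable g -> (forall v, 0 <= g v) ->
    \int[semidirect]_v g v = \int[mu]_x kmean g x.
  have := ge0 (fun v => f v + B).
  rewrite meanD//; last exact: bm_cst.
  have -> : kmean (fun v => f v + B) = fun x => kmean f x + B.
    apply/funext => x; rewrite /kmean meanD ?mean_cst//.
    - exact: bm_snoc.
    - exact: bm_cst.
  rewrite meanD//; [|exact: bm_kmean|exact: bm_cst].
  rewrite !mean_cst => h; apply: (addIr B); apply: h.
    by apply: bmD => //; exact: bm_cst.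
  by move=> v; have := fB v; rewrite ler_norml => /andP[]; lra.
move=> bg g0; apply: EFin_inj; rewrite -!bm_integralE//; last exact: bm_kmean.
have := @integral_kcomp _ _ _ _ _ _ _ kconst ksnoc tt (fun v => (g v)%:E) _ _.
rewrite /semidirect => -> //; last by apply/measurable_EFinP; case: bg.
apply: eq_integral => x _; rewrite /kmean -bm_integralE; last exact: bm_snoc.
rewrite ge0_integral_distribution//; first by apply/measurable_EFinP; case: bg.
Qed.

End semidirect.

(** * Continuity of the conditional means *)

Lemma prob_tail {R : realType} (m : probability R R) (e : R) : 0 < e ->
  exists M : R, fine (m (~` `[- M, M]%classic)) < e.
Proof.
move=> e0; pose S (n : nat) : set R := `[- n%:R, n%:R]%classic.
have mS n : measurable (~` S n) by apply: measurableC; exact: measurable_itv.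
have : \int[m]_z (\1_(~` S n) z : R) @[n --> \oo] --> \int[m]_z (0 : R).
  apply: (@mean_dominated _ _ _ _ _ _ 1).
  - by move=> n; exact: bm_indic.
  - exact: bm_cst.
  - by move=> n z; rewrite indicE; case: (_ \in _); rewrite ?normr1 ?normr0.
  - move=> z; apply: cvg_near_cst; near=> n.
    rewrite indicE memNset//; apply; rewrite /S/= in_itv/= -ler_norml.
    by near: n; exact: nbhs_infty_ger.
rewrite mean_cst => /cvgr_lt /(_ _ e0)[n _ /(_ n (leqnn n))] h.
by exists n%:R; have := mean_indic m (mS n) => /(congr1 fine) /= <-.
Unshelve. all: by end_near. Qed.

Section stability.
Context {R : realType} (N : R -> R) (hN : is_norm (N : R^o -> R)).
Context {k : nat} (f : 'rV[R]_k.+1 -> R).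
Hypothesis bf : bounded_continuous f.

Lemma snoc_near (x : 'rV[R]_k) (z e : R) : 0 < e -> exists2 r, 0 < r &
  forall x' z', ball x r x' -> `|z' - z| < r ->
    `|f (snoc x' z') - f (snoc x z)| < e.
Proof.
move=> e0; have [cf _] := bf.
have /nbhs_ballP[r /= r0 rf] :
    nbhs (snoc x z) [set v | `|f (snoc x z) - f v| < e].
  exact: (cf (snoc x z) _ (nbhsx_ballx (f (snoc x z)) e e0)).
exists r => // x' z' [_ xx'] zz'; rewrite distrC; apply: rf; split => // i j.
rewrite ord1 !mxE; case: unliftP => [j'|] _; first exact: xx'.
by rewrite /ball/= distrC.
Qed.

(** Continuity of [f] at the points [(x, z)] is uniform over [z] in a compact
set. *)
Lemma snoc_tube (x : 'rV[R]_k) (S : set R) (e : R) : compact S -> 0 < e ->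
  exists2 r, 0 < r & forall z, S z ->
  forall x' z', ball x r x' -> `|z' - z| < r ->
    `|f (snoc x' z') - f (snoc x z)| <= e.
Proof.
move=> cS e0.
have : \forall r \near 0^'+, S `<=` (fun z => forall x' z', ball x r x' ->
    `|z' - z| < r -> `|f (snoc x' z') - f (snoc x z)| <= e).
  apply: ((compact_near_coveringP S).1 cS) => z0 Sz0.
  have e20 : 0 < e / 2 by rewrite divr_gt0.
  have [r r0 hr] := snoc_near x z0 e20.
  have r20 : 0 < r / 2 by rewrite divr_gt0.
  (* halving the radius leaves room for a second point within r / 2 *)
  exists (ball z0 (r / 2), [set s | s < r / 2]) => /=.
    by split; [exact: nbhsx_ballx|exact: nbhs_right_lt].
  move=> [z s] /= [zz0 sr] x' z' xx' zz'.
  have h1 : `|f (snoc x' z') - f (snoc x z0)| < e / 2.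
    apply: hr; first by apply: le_ball xx'; lra.
    rewrite -(subrK z z') -addrA (le_lt_trans (ler_normD _ _))//.
    by move: zz0; rewrite /ball/= distrC; lra.
  have h2 : `|f (snoc x z) - f (snoc x z0)| < e / 2.
    apply: hr; first exact: ballxx.
    by move: zz0; rewrite /ball/= distrC; lra.
  rewrite -(subrK (f (snoc x z0)) (f (snoc x' z'))) -addrA.
  rewrite (le_trans (ler_normD _ _))// [X in _ + X]distrC; lra.
move=> h; near (0:R)^'+ => r.
exists r; first by near: r; exact: nbhs_right_gt.
by near: r.
Unshelve. all: by end_near. Qed.

(** [m0], [m] and [m'] stand for the limit kernel at [x], the limit kernel at a
nearby [x'], and the approximating kernel at [x'].  Each comparison uses its
own coupling, so the triangle inequality for the distance, which would require
gluing couplings, is avoided; in exchange the second comparison needs the tail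
of [m], which the first coupling provides. *)
Lemma kernel_stability (x : 'rV[R]_k) (m0 : probability R R) (e : R) : 0 < e ->
  exists2 c, 0 < c & exists2 r, 0 < r & forall x', ball x r x' ->
  forall m m' : probability R R,
    (dist_d N m m0 < c%:E)%E ->
    `|\int[m]_z f (snoc x' z) - \int[m0]_z f (snoc x z)| <= e /\
    ((dist_d N m' m < c%:E)%E ->
    `|\int[m']_z f (snoc x' z) - \int[m]_z f (snoc x' z)| <= e).
Proof.
move=> e0; have [_ [B0 fB0]] := bf; pose B := Num.max 1 B0.
have B1 : 1 <= B by rewrite le_max lexx.
have Bgt0 : 0 < B by apply: lt_le_trans B1.
have fB v : `|f v| <= B by rewrite le_max fB0 orbT.
(* [d] bounds both the oscillation of [f] on the compact part and the mass
   that is neglected. The second comparison collects 2 d from the oscillation,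
   2 B (2 d + 2 K1 c) from the tail of [m] and 2 B K2 c from the coupling; with
   B d and B (K1 + K2) c equal to e / 16 these stay below [e]. *)
pose d := e / 16 / B.
have d0 : 0 < d by rewrite !divr_gt0.
have dE : B * d = e / 16 by rewrite /d mulrC divfK// gt_eqF.
have de : d <= e / 16.
  by rewrite -dE ler_peMl// ltW.
have [M SM] := prob_tail m0 d0.
pose S : set R := `[- M, M]%classic.
pose S1 : set R := `[- (M + 1), M + 1]%classic.
have mS : measurable S by exact: measurable_itv.
have mS1 : measurable S1 by exact: measurable_itv.
have cS1 : compact S1 by exact: segment_compact.
have SS1 : S `<=` S1.
  move=> z; rewrite /S /S1/= !in_itv/= => /andP[h1 h2]; apply/andP; split; lra.
have SS1' z z' : S z -> `|z' - z| < 1 -> S1 z'.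
  rewrite /S /S1/= !in_itv/= ltr_distl => /andP[h1 h2] /andP[h3 h4].
  by apply/andP; split; lra.
have [r r0 tube] := snoc_tube x cS1 d0.
pose K1 := cost_factor N 1; pose K2 := cost_factor N r.
have K10 : 0 < K1 by exact: (cost_factor_gt0 hN).
have K20 : 0 < K2 by exact: (cost_factor_gt0 hN).
pose c := e / 16 / (B * (K1 + K2)).
have c0 : 0 < c by rewrite !divr_gt0// mulr_gt0// addr_gt0.
have cE : B * K1 * c + B * K2 * c = e / 16.
  by rewrite -mulrDl -mulrDr mulrC divfK// gt_eqF// mulr_gt0// addr_gt0.
have BK1 : 0 < B * K1 * c by apply: mulr_gt0 => //; exact: mulr_gt0.
have BK2 : 0 < B * K2 * c by apply: mulr_gt0 => //; exact: mulr_gt0.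
exists c => //; exists r => // x' xx' m m' mm0; split => [|m'm].
  have := coupling_bound hN (bm_snoc x' (bc_bm bf)) (bm_snoc x (bc_bm bf))
    (fun z => fB _) (fun z => fB _) mS r0 (ltW d0)
    (fun z z' Sz => tube z (SS1 z Sz) x' z' xx') mm0.
  move=> /le_trans; apply.
  have := ler_wpM2l (ltW Bgt0) (ltW SM); rewrite dE -/S -/K2 => h.
  by rewrite -!(mulrA 2) in h *; lra.
have tail := coupling_tail hN mS mS1 SS1' mm0.
have h0 : fine (m (~` S1)) <= 2 * d + 2 * K1 * c.
  by apply: le_trans tail _; rewrite -/S -/K1; move: SM; rewrite -/S; lra.
have := coupling_bound hN (bm_snoc x' (bc_bm bf)) (bm_snoc x' (bc_bm bf))
    (fun z => fB _) (fun z => fB _) mS1 r0 (ltW (addr_gt0 d0 d0)) _ m'm.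
move=> /(_ _)/le_trans; apply.
  move=> z z' S1z zz'.
  have h1 := tube z S1z x' z' xx' zz'.
  have h2 := tube z S1z x' z xx'.
  rewrite subrr normr0 in h2; have {}h2 := h2 r0.
  rewrite -(subrK (f (snoc x z)) (f (snoc x' z'))) -addrA.
  by rewrite (le_trans (ler_normD _ _))// [X in _ + X]distrC lerD.
rewrite -/K2; have := ler_wpM2l (ltW Bgt0) h0.
rewrite mulrDr (mulrCA B 2 d) dE (mulrCA B _ c) => h.
have {}h : B * fine (m (~` S1)) <= 2 * (e / 16) + 2 * (B * K1 * c).
  by apply: le_trans h _; rewrite le_eqVlt; apply/orP; left; apply/eqP; ring.
rewrite -!(mulrA 2) ; lra.
Qed.

End stability.

(** Half of the equivalence of norms in finite dimension, by expanding [y - x]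
in the canonical basis. *)
Lemma norm_rV_le {R : realType} {p : nat} (N : 'rV[R]_p -> R) (hN : is_norm N) :
  exists2 C : R, 0 < C &
    forall (x y : 'rV[R]_p) (r : R), ball x r y -> N (y - x) <= C * r.
Proof.
case: hN => _ NZ ND.
have N0 : N 0 = 0 by have := NZ 0 0; rewrite scale0r normr0 mul0r.
have Nge0 v : 0 <= N v.
  have := ND v (-1 *: v); rewrite NZ normrN1 mul1r scaleN1r subrr N0; lra.
pose C : R := \sum_(j < p) N (delta_mx 0 j).
have C0 : 0 <= C by apply: sumr_ge0 => j _.
exists (1 + C) => [|x y r [r0 xy]]; first by lra.
rewrite [X in N X]row_sum_delta.
have Nsum (I : Type) (s : seq I) (F : I -> 'rV[R]_p) :
    N (\sum_(i <- s) F i) <= \sum_(i <- s) N (F i).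
  elim: s => [|i s IHs]; first by rewrite !big_nil N0.
  by rewrite !big_cons (le_trans (ND _ _))// lerD2l.
rewrite (le_trans (Nsum _ _ _))// (@le_trans _ _ (C * r))//; last first.
  by rewrite ler_wpM2r ?(ltW r0)// lerDr.
rewrite /C mulr_suml; apply: ler_sum => j _; rewrite NZ mulrC ler_wpM2l//.
by rewrite ltW// !mxE distrC; exact: xy.
Qed.

(** The balls of [normp] are neighbourhoods, since [normp] is bounded by a
multiple of the sup norm. *)
Lemma near_dist_d {R : realType} {p : nat} (N : R -> R) (normp : 'rV[R]_p -> R)
    (K : R.-pker 'rV[R]_p ~> R) :
  is_norm (N : R^o -> R) -> is_norm normp ->
  (forall y : 'rV[R]_p,
     ereal_sup [set dist_d N (K y) (K y')
               | y' in [set y' | normp (y' - y) <= delta]]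
       @[delta --> 0^'+] --> 0%E) ->
  forall (y : 'rV[R]_p) (c : R), 0 < c ->
    \forall y' \near y, (dist_d N (K y') (K y) < c%:E)%E.
Proof.
move=> hN hnormp hii y c c0; have [C C0 hC] := norm_rV_le hnormp.
have nb : nbhs (0%E : \bar R) [set u | (u < c%:E)%E].
  by apply: open_ereal_lt'; rewrite lte_fin.
have h := hii y _ nb.
near (0:R)^'+ => delta.
have d0 : 0 < delta by near: delta; exact: nbhs_right_gt.
have hd : (ereal_sup [set dist_d N (K y) (K y')
    | y' in [set y' | (normp (y' - y) <= delta)%R]] < c%:E)%E.
  by near: delta.
near=> y'; apply: (dist_d_lt_sym hN); apply: le_lt_trans hd.
apply: ereal_sup_ubound; exists y' => //=.
have yy' : ball y (delta / C) y'.
  by near: y'; apply: nbhsx_ballx; rewrite divr_gt0.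
by rewrite (le_trans (hC _ _ _ yy'))// mulrC divfK// gt_eqF.
Unshelve. all: by end_near. Qed.

Section kernel_convergence.
Context {R : realType} (N : R -> R) (hN : is_norm (N : R^o -> R)).
Context {p : nat} (K : R.-pker 'rV[R]_p ~> R).
Variable Kn : nat -> R.-pker 'rV[R]_p ~> R.
Hypothesis hi : forall A : set 'rV[R]_p, compact A -> A !=set0 ->
  ereal_sup [set dist_d N (Kn n y) (K y) | y in A] @[n --> \oo] --> 0%E.
Hypothesis hc : forall (y : 'rV[R]_p) (c : R), 0 < c ->
  \forall y' \near y, (dist_d N (K y') (K y) < c%:E)%E.
Context {k : nat} (pi : {mfun 'rV[R]_k >-> 'rV[R]_p}) (cpi : continuous pi).
Variable f : 'rV[R]_k.+1 -> R.
Hypothesis bf : bounded_continuous f.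

Lemma kmean_continuous : bounded_continuous (kmean pi K f).
Proof.
split; last first.
  have [_ [B fB]] := bf; exists B => x; apply: mean_le_cst => //.
  exact/bm_snoc/bc_bm.
move=> x; apply/(@cvgrPdist_le _ R^o _ (nbhs x)) => e e0.
have [c c0 [r r0 stab]] := kernel_stability hN bf x (kprob K (pi x)) e0.
near=> x'; rewrite distrC.
have xx' : ball x r x' by near: x'; exact: nbhsx_ballx.
have := stab x' xx' (kprob K (pi x')) (kprob K (pi x')) _.
move=> h; apply: (h _).1.
by near: x'; exact: (cpi (hc (pi x) c0)).
Unshelve. all: by end_near. Qed.

(** Local estimates near each point, for all large indices, become uniform on a
compact set by the near-covering form of compactness. *)
Lemma kmean_uniform (A : set 'rV[R]_k) (e : R) : compact A -> 0 < e ->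
  \forall n \near \oo, forall x, A x ->
    `|kmean pi (Kn n) f x - kmean pi K f x| <= e.
Proof.
move=> cA e0; have [->|/set0P A0] := eqVneq A set0.
  by apply: nearW => n x.
have cpA : compact (pi @` A).
  by apply: continuous_compact => //; exact: continuous_subspaceT.
have pA0 : (pi @` A) !=set0 by have [a Aa] := A0; exists (pi a); exists a.
have /near_covering_withinP := (compact_near_coveringP A).1 cA.
apply => x Ax.
have [c c0 [r r0 stab]] := kernel_stability hN bf x (kprob K (pi x)) e0.
pose sup_d n := ereal_sup [set dist_d N (Kn n y) (K y) | y in pi @` A].
have nearc : \forall n \near \oo, (sup_d n < c%:E)%E.
  have nb : nbhs (0%E : \bar R) [set u | (u < c%:E)%E].
    by apply: open_ereal_lt'; rewrite lte_fin.
  exact: (hi cpA pA0 nb).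
exists (ball x r `&` [set x' | (dist_d N (K (pi x')) (K (pi x)) < c%:E)%E],
        [set n | (sup_d n < c%:E)%E]) => /=.
  split => //; apply: filterI; first exact: nbhsx_ballx.
  exact: (cpi (hc (pi x) c0)).
move=> [x' n] /= [[xx' dx'] nc] Ax'.
have [_] := stab x' xx' (kprob K (pi x')) (kprob (Kn n) (pi x')) dx'.
apply; apply: le_lt_trans nc; apply: ereal_sup_ubound.
by exists (pi x') => //; exists x'.
Qed.

(** The means of the conditional means are compared in two steps: replacing the
approximating kernel by the limit one costs little on a compact set that
carries most of the mass, and then the weak convergence of [mu n] applies to
the continuous function [kmean pi K f]. *)
Lemma semidirect_cvg (U : set_system nat) {FU : Filter U}
    (mu : nat -> probability 'rV[R]_k R) (nu : probability 'rV[R]_k R) :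
  (forall S, (\forall n \near \oo, S n) -> U S) ->
  (forall e : R, 0 < e -> exists2 A : set 'rV[R]_k, compact A /\ measurable A &
    forall n, fine (mu n (~` A)) <= e) ->
  (forall g, bounded_continuous g ->
    \int[mu n]_x g x @[n --> U] --> \int[nu]_x g x) ->
  \int[semidirect pi (mu n) (Kn n)]_v f v @[n --> U] -->
    \int[semidirect pi nu K]_v f v.
Proof.
move=> UF tmu wmu.
have bg := kmean_continuous.
have bmf := bc_bm bf.
rewrite (mean_semidirect _ _ _ bmf).
rewrite (_ : (fun n => _) =
    (fun n => \int[mu n]_x kmean pi (Kn n) f x)); last first.
  by apply/funext => n; rewrite mean_semidirect.
apply/cvgrPdist_le => e e0.
have [_ [B0 fB0]] := bf; pose B := Num.max 1 B0.
have B1 : 1 <= B by rewrite le_max lexx.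
have Bgt0 : 0 < B by apply: lt_le_trans B1.
have fB v : `|f v| <= B by rewrite le_max fB0 orbT.
have kB (L : R.-pker 'rV[R]_p ~> R) x : `|kmean pi L f x| <= B.
  by apply: mean_le_cst => //; exact/bm_snoc/bc_bm.
have e40 : 0 < e / 4 by rewrite divr_gt0.
have d0 : 0 < e / 4 / B by rewrite divr_gt0.
have [A [cA mA] tA] := tmu _ d0.
have hunif := UF _ (kmean_uniform cA e40).
move/cvgrPdist_le : (wmu _ bg) => /(_ _ e40) hw.
apply: filterS2 hunif hw => n hn hw.
have mAC := measurableC mA.
have bI : bounded_measurable (fun x => 2 * B * (\1_(~` A) x : R)).
  by apply: bmZ; exact: bm_indic.
have bn : bounded_measurable (kmean pi (Kn n) f) by exact: bm_kmean.
have b1 : bounded_measurable (kmean pi K f) by exact: bm_kmean.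
have : `|\int[mu n]_x kmean pi (Kn n) f x - \int[mu n]_x kmean pi K f x| <=
    e / 4 + 2 * B * (e / 4 / B).
  rewrite -meanB// (le_trans (mean_norm _ (bmB bn b1)))//.
  apply: (@le_trans _ _ (\int[mu n]_x (e / 4 + 2 * B * (\1_(~` A) x : R)))).
    apply: mean_le.
    - by apply: bm_norm; exact: bmB.
    - by apply: bmD => //; exact: bm_cst.
    - move=> x; have [Ax|Ax] := pselect (A x).
        by rewrite indicE memNset ?mulr0 ?addr0/=; [exact: hn|apply].
      rewrite indicE mem_set//= mulr1 (le_trans (ler_normB _ _))//.
      by have := kB (Kn n) x; have := kB K x; lra.
  rewrite meanD//; last exact: bm_cst.
  rewrite mean_cst meanZ; last exact: bm_indic.
  rewrite lerD2l ler_pM2l ?mulr_gt0//.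
  by have := mean_indic (mu n) mAC => /(congr1 fine) /= ->.
have -> : 2 * B * (e / 4 / B) = e / 2.
  by rewrite -mulrA (mulrCA B) divff ?gt_eqF// mulr1; field.
move: hw; rewrite !ler_norml => /andP[h1 h2] /andP[h3 h4].
by apply/andP; split; lra.
Qed.

End kernel_convergence.

(** * Finite-dimensional laws of Markov processes *)

Lemma continuous_to_rV {R : realType} {k : nat} (T : topologicalType)
    (X : T -> 'rV[R]_k) :
  (forall i, continuous (fun w => X w ord0 i)) -> continuous X.
Proof.
move=> cX w A [P nP PA].
have : \forall w' \near w, forall i, P ord0 i (X w' ord0 i).
  by apply: filter_forall => i; exact: (cX i w _ (nP ord0 i)).
by apply: filterS => w' h; apply: PA => i j; rewrite ord1.
Qed.

Section reindex_rV.
Context {R : realType} {k l : nat} (s : 'I_l -> 'I_k).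

Definition reindex_rV (x : 'rV[R]_k) : 'rV[R]_l := \row_i x ord0 (s i).

Lemma measurable_reindex : measurable_fun setT reindex_rV.
Proof.
apply: measurable_fun_rV => i; under eq_fun do rewrite mxE.
exact: measurable_coord.
Qed.

HB.instance Definition _ :=
  isMeasurableFun.Build _ _ _ _ reindex_rV measurable_reindex.

Lemma continuous_reindex : continuous reindex_rV.
Proof.
apply: continuous_to_rV => i; under [X in continuous X]eq_fun do rewrite mxE.
exact: coord_continuous.
Qed.

Lemma bc_reindex f :
  bounded_continuous f -> bounded_continuous (f \o reindex_rV).
Proof.
move=> [cf [B fB]]; split; last by exists B => x; exact: fB.
by move=> x; apply: continuous_comp; [exact: continuous_reindex|exact: cf].
Qed.

End reindex_rV.

(** The last [p] values, most recent first, as a transition kernel expects. *)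
Definition recent {R : realType} {k p : nat} (le_pk : (p <= k)%N) :
    {mfun 'rV[R]_k >-> 'rV[R]_p} :=
  reindex_rV (fun i => rev_ord (widen_ord le_pk i)).

Section law1.
Context d (Omega : measurableType d) (R : realType) (P : probability Omega R).
Variables (Y : int -> {RV P >-> R}) (p : nat) (K : R.-pker 'rV[R]_p ~> R).
Hypotheses (hmarkov : markov_of_order Y p) (hK : transition_kernel Y K).

Lemma mean_law1_reindex k l (s : 'I_l -> 'I_k) (u : 'I_k -> int) f :
  bounded_measurable f ->
  \int[law Y u]_x f (reindex_rV s x) = \int[law Y (fun i => u (s i))]_x f x.
Proof.
move=> bf; rewrite /law !mean_distribution//; last first.
  by apply: (bm_comp (measurable_reindex s) bf).
by apply: eq_mean => w; congr f; apply/rowP => i; rewrite !mxE.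
Qed.

Lemma sigma_past_rvec k (A : set 'rV[R]_k) : measurable A ->
  sigma_past Y k.+1 (rvec Y (fun i : 'I_k => i.+1%:Z) @^-1` A).
Proof.
pose C : set_system 'rV[R]_k := [set A | sigma_past Y k.+1
  (rvec Y (fun i : 'I_k => i.+1%:Z) @^-1` A)].
move: A; suff : measurable `<=` C by [].
apply: rV_measurable_sub.
  split; rewrite /C /sigma_past /=.
  - by rewrite preimage_set0; exact: sigma_algebra0.
  - by move=> S CS; rewrite setTD preimage_setC; exact: sigma_algebraC.
  - by move=> F CF; rewrite preimage_bigcup; exact: sigma_algebra_bigcup.
move=> i a; apply: sub_sigma_algebra; exists (i.+1%:Z) => /=.
  by rewrite ltz_nat ltnS ltn_ord.
exists `]a, +oo[%classic; first exact: measurable_itv.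
by rewrite setTI; apply/seteqP; split => w /=; rewrite mxE in_itv/= andbT.
Qed.

(** On rectangles this is the defining property of the conditional probability
given the whole past, which the Markov property identifies with the
transition kernel. *)
Lemma law1_succ k (le_pk : (p <= k)%N) A : measurable A ->
  law1 Y k.+1 A = semidirect (recent le_pk) (law1 Y k) K A.
Proof.
pose D : set_system 'rV[R]_k.+1 := [set A | exists A1 B1,
  [/\ measurable A1, measurable B1 &
    A = [set v | A1 (init_rV v) /\ B1 (v ord0 ord_max)]]].
apply: (probability_rV_eq (D := D)).
- move=> _ _ [A1 [B1 [mA1 mB1 ->]]] [A2 [B2 [mA2 mB2 ->]]].
  exists (A1 `&` A2), (B1 `&` B2); split; [exact: measurableI..|].
  by apply/seteqP; split => v /=; tauto.
- move=> _ [A1 [B1 [mA1 mB1 ->]]]; apply: measurableI.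
    by rewrite -[X in measurable X]setTI; exact: measurable_init.
  by rewrite -[X in measurable X]setTI; exact: measurable_coord.
- by exists setT, setT; split => //; apply/seteqP; split.
- move=> i a; case: (unliftP ord_max i) => [j|] ->.
    exists [set x : 'rV[R]_k | a < x ord0 j], setT; split => //; last first.
      by apply/seteqP; split => v /=; rewrite mxE; tauto.
    have := @measurable_coord R k j measurableT _ (measurable_itv `]a, +oo[%R).
    rewrite setTI; congr (measurable _); apply/seteqP.
    by split => v /=; rewrite in_itv/= andbT.
  exists setT, `]a, +oo[%classic; split => //.
  by apply/seteqP; split => v /=; rewrite in_itv/= andbT; tauto.
- move=> _ [A1 [B1 [mA1 mB1 ->]]].
  pose t : int := k.+1.
  pose E := rvec Y (fun i : 'I_k => i.+1%:Z) @^-1` A1.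
  have [_ _ /(_ E (sigma_past_rvec mA1)) hE] := hmarkov mB1 (hK t mB1).
  transitivity (P (Y t @^-1` B1 `&` E)).
    rewrite /law1 /law /distribution/= /pushforward; congr (P _).
    have initE w : init_rV (rvec Y (fun i : 'I_k.+1 => i.+1%:Z) w) =
        rvec Y (fun i : 'I_k => i.+1%:Z) w.
      by apply/rowP => j; rewrite !mxE lift_max.
    by apply/seteqP; split => w /=; rewrite initE !mxE /= => -[].
  rewrite -hE; apply: etrans (esym (semidirectE _ _ _ _)).
  transitivity (\int[law1 Y k]_(x in A1) K (recent le_pk x) B1)%E.
    rewrite /law1 /law /distribution ge0_integral_pushforward//=; last first.
      apply: measurable_funTS.
      apply: (measurableT_comp (measurable_kernel K _ mB1)).
      exact: measurable_funPT.
    apply: eq_integral => w _ /=; congr (K _ B1); apply/rowP => i.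
    rewrite !mxE /=; congr (Y _ w); have := ltn_ord i; rewrite /t; lia.
  rewrite integral_mkcond; apply: eq_integral => x _ /=.
  rewrite patchE; case: ifPn => [/set_mem A1x|/negP A1x].
    congr (K _ _).
    by apply/seteqP; split => z /=; rewrite init_snoc snoc_max; tauto.
  rewrite -[LHS](measure0 (K (recent le_pk x))); congr (K _ _).
  apply/seteqP; split => z //=; rewrite init_snoc => -[/mem_set].
  by move=> /A1x.
Qed.

End law1.

(** A box whose [k] sides each carry mass at least [1 - e / (k+1)]. *)
Lemma law1_tight (R : realType) (dn : nat -> measure_display)
    (Omegan : forall n, measurableType (dn n))
    (Pn : forall n, probability (Omegan n) R)
    (Yn : forall n, int -> {RV (Pn n) >-> R})
    (htight : forall t : int, tight (fun n => distribution (Pn n) (Yn n t)))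
    k (e : R) :
  0 < e -> exists2 A : set 'rV[R]_k, compact A /\ measurable A &
    forall n, fine (law1 (Yn n) k (~` A)) <= e.
Proof.
move=> e0; have ek0 : 0 < e / k.+1%:R by rewrite divr_gt0.
have /(_ _)/cid2-/all_sig[S] : forall i : 'I_k, exists2 S : set R, compact S &
    forall n,
      (distribution (Pn n) (Yn n (i.+1%:Z)) (~` S) <= (e / k.+1%:R)%:E)%E.
  by move=> i; exact: htight.
move=> /all_and2[cS hS].
pose A := [set v : 'rV[R]_k | forall i, S i (v ord0 i)].
have mS i : measurable (S i) by exact: compact_measurable.
have mSC i : measurable (~` S i) by exact: measurableC.
have mA : measurable A.
  rewrite (_ : A = \bigcap_(i in [set: 'I_k])
      ((fun v : 'rV[R]_k => v ord0 i) @^-1` S i)).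
    apply: fin_bigcap_measurable => // i _.
    by rewrite -[X in measurable X]setTI; exact: measurable_coord.
  by apply/seteqP; split => [v Av i _|v Av i]; exact: Av.
exists A; first by split => //; exact: rV_compact.
move=> n; have mAC := measurableC mA.
have bi (i : 'I_k) :
    bounded_measurable (fun v : 'rV[R]_k => \1_(~` S i) (v ord0 i) : R).
  by apply: (bm_comp (measurable_coord i)); exact: bm_indic.
have [bS ES] := mean_sum (law1 (Yn n) k) (index_enum 'I_k) bi.
have := mean_indic (law1 (Yn n) k) mAC => /(congr1 fine) /= <-.
apply: (@le_trans _ _
  (\int[law1 (Yn n) k]_v (\sum_(i < k) (\1_(~` S i) (v ord0 i) : R)))).
  apply: mean_le => //; first exact: bm_indic.
  move=> v; rewrite indicE.
  case: (boolP (v \in ~` A)) => [/set_mem/existsNP[i Sv]|_].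
    rewrite (bigD1 i)//= indicE mem_set//= lerDl sumr_ge0//.
  by apply: sumr_ge0 => j _; rewrite ?indicE ler0n.
rewrite ES (@le_trans _ _ (\sum_(i < k) e / k.+1%:R))//; last first.
  rewrite sumr_const card_ord -[_ *+ k]mulr_natr mulrAC.
  by rewrite ler_pdivrMr// ler_pM2l// ler_nat.
apply: ler_sum => i _.
rewrite mean_distribution//; under eq_mean do rewrite mxE.
rewrite -(mean_distribution (Yn n i.+1%:Z) (bm_indic R (mSC i))).
by rewrite -lee_fin mean_indic//; exact: hS.
Qed.

(** * Convergence of the finite-dimensional laws *)

Section main.
Context (R : realType) (p : nat)
  (d : measure_display) (Omega : measurableType d) (P : probability Omega R)
  (Y : int -> {RV P >-> R})
  (dn : nat -> measure_display) (Omegan : forall n, measurableType (dn n))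
  (Pn : forall n, probability (Omegan n) R)
  (Yn : forall n, int -> {RV (Pn n) >-> R})
  (K : R.-pker 'rV[R]_p ~> R) (Kn : nat -> R.-pker 'rV[R]_p ~> R)
  (N : R -> R) (hN : is_norm (N : R^o -> R))
  (hmarkov : markov_of_order Y p) (hK : transition_kernel Y K)
  (hstatn : forall n, stationary (Yn n))
  (hmarkovn : forall n, markov_of_order (Yn n) p)
  (hKn : forall n, transition_kernel (Yn n) (Kn n))
  (hi : forall A : set 'rV[R]_p, compact A -> A !=set0 ->
     ereal_sup [set dist_d N (Kn n y) (K y) | y in A] @[n --> \oo] --> 0%E)
  (hc : forall (y : 'rV[R]_p) (c : R), 0 < c ->
     \forall y' \near y, (dist_d N (K y') (K y) < c%:E)%E)
  (htight : forall t : int, tight (fun n => distribution (Pn n) (Yn n t)))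
  (hunique : forall nu : probability 'rV[R]_p R, stationary_distribution K nu ->
       forall A, measurable A -> nu A = law1 Y p A).

Lemma law1_succ_cvg k (le_pk : (p <= k)%N) (U : set_system nat) {FU : Filter U}
    (nu : probability 'rV[R]_k R) :
  (forall S, (\forall n \near \oo, S n) -> U S) ->
  (forall g, bounded_continuous g ->
    \int[law1 (Yn n) k]_x g x @[n --> U] --> \int[nu]_x g x) ->
  forall f, bounded_continuous f ->
  \int[law1 (Yn n) k.+1]_v f v @[n --> U] -->
    \int[semidirect (recent le_pk) nu K]_v f v.
Proof.
move=> UF wnu f bf.
rewrite (_ : (fun n => _) =
    (fun n => \int[semidirect (recent le_pk) (law1 (Yn n) k) (Kn n)]_v f v)).
  apply: (semidirect_cvg hN hi hc) => //; first exact: continuous_reindex.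
  by move=> e e0; exact: law1_tight.
by apply/funext => n; apply: eq_mean_measure => A mA; exact: law1_succ.
Qed.

(** Forgetting the first of [p+1] values of the approximating process leaves its
[p]-dimensional law unchanged, by stationarity, while [law1_succ_cvg] gives the
limit of the [p+1]-dimensional law. *)
Lemma ultra_limit_stationary (U : set_system nat) {FU : ProperFilter U}
    (nu : probability 'rV[R]_p R) :
  (forall S, (\forall n \near \oo, S n) -> U S) ->
  (forall g, bounded_continuous g ->
    \int[law1 (Yn n) p]_x g x @[n --> U] --> \int[nu]_x g x) ->
  stationary_distribution K nu.
Proof.
move=> UF wnu.
pose nu' := semidirect (recent (leqnn p)) nu K.
pose tl := @reindex_rV R p.+1 p (lift ord0).
suff eqnu A : measurable A -> nu A = distribution nu' tl A.
  move=> A mA; rewrite eqnu//; apply: etrans (semidirectE _ _ _ _) _.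
  apply: eq_integral => x _; congr (K _ _).
    by apply/rowP => i; rewrite !mxE; congr (x _ _); exact: val_inj.
  suff tlE z : tl (snoc x z) = shift_in x z by apply/funext => z; congr (A _).
  apply/rowP => i; rewrite !mxE.
  case: insubP => [j /= ij ji|/= ij].
    have -> : lift ord0 i = lift ord_max j.
      by apply: ord_inj; rewrite lift_max ji.
    by rewrite liftK.
  have -> : lift ord0 i = ord_max.
    by apply: val_inj => /=; rewrite /bump/=; have := ltn_ord i; lia.
  by rewrite unlift_none.
move: A; apply: probability_rV_eq_bc => f bf.
have bmf := bc_bm bf.
rewrite mean_distribution//.
have h := law1_succ_cvg (le_pk := leqnn p) UF wnu (bc_reindex (lift ord0) bf).
have h' := wnu f bf.
have E : (fun n => \int[law1 (Yn n) p.+1]_x (f \o tl) x) =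
    (fun n => \int[law1 (Yn n) p]_x f x).
  apply/funext => n; rewrite /law1 mean_law1_reindex//.
  transitivity (\int[law (Yn n) (fun i : 'I_p => i.+1%:Z + 1)]_x f x).
    congr (\int[law (Yn n) _]_x f x); apply/funext => i /=.
    by rewrite /bump/=; lia.
  by apply: eq_mean_measure => A mA; exact: hstatn.
rewrite E in h.
exact: (cvg_unique (@Rhausdorff R) h' (h _)).
Qed.

(** Every ultrafilter limit is stationary, hence equal to the law of the limit
process by uniqueness. *)
Lemma law1_cvg_order f : bounded_continuous f ->
  \int[law1 (Yn n) p]_x f x @[n --> \oo] --> \int[law1 Y p]_x f x.
Proof.
move=> bf; apply: cvg_ultra => U UU UF.
have [nu hnu] := tight_ultra_limit UU (fun e => law1_tight htight p (e := e)).
have pU := @ultra_proper _ _ UU.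
rewrite -(eq_mean_measure f (hunique (ultra_limit_stationary UF hnu))).
exact: hnu.
Qed.

Lemma law1_cvg_ge j f : bounded_continuous f ->
  \int[law1 (Yn n) (j + p)]_x f x @[n --> \oo] --> \int[law1 Y (j + p)]_x f x.
Proof.
elim: j f => [|j IHj] f bf; first exact: law1_cvg_order.
have le_p : (p <= j + p)%N by exact: leq_addl.
rewrite (eq_mean_measure f (law1_succ hmarkov hK le_p)).
exact: law1_succ_cvg.
Qed.

Lemma law1_cvg k f : bounded_continuous f ->
  \int[law1 (Yn n) k]_x f x @[n --> \oo] --> \int[law1 Y k]_x f x.
Proof.
move=> bf; pose s := widen_ord (leq_addr p k).
have := law1_cvg_ge (bc_reindex s bf).
have bmf := bc_bm bf.
rewrite /law1 mean_law1_reindex//.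
rewrite (_ : (fun n => _) = (fun n => \int[law1 (Yn n) k]_x f x))//.
by apply/funext => n; rewrite /law1 mean_law1_reindex.
Qed.

End main.

Theorem lemma4p2 (R : realType) (p : nat) (hp : (0 < p)%N)
  (d : measure_display) (Omega : measurableType d) (P : probability Omega R)
  (Y : int -> {RV P >-> R})
  (dn : nat -> measure_display) (Omegan : forall n, measurableType (dn n))
  (Pn : forall n, probability (Omegan n) R)
  (Yn : forall n, int -> {RV (Pn n) >-> R})
  (kappa : R.-pker 'rV[R]_p ~> R) (kappan : nat -> R.-pker 'rV[R]_p ~> R)
  (normd : R -> R) (normp : 'rV[R]_p -> R)
  (hnormd : is_norm (normd : R^o -> R)) (hnormp : is_norm normp)
  (hstat : stationary Y) (hmarkov : markov_of_order Y p)
  (hkappa : transition_kernel Y kappa)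
  (hstatn : forall n, stationary (Yn n)) (hmarkovn : forall n, markov_of_order (Yn n) p)
  (hkappan : forall n, transition_kernel (Yn n) (kappan n))
  (hi : forall K : set 'rV[R]_p, compact K -> K !=set0 ->
     ereal_sup [set dist_d normd (kappan n y) (kappa y) | y in K]
       @[n --> \oo] --> 0%E)
  (hii : forall y : 'rV[R]_p,
     ereal_sup [set dist_d normd (kappa y) (kappa y')
               | y' in [set y' | normp (y' - y) <= delta]]
       @[delta --> 0^'+] --> 0%E)
  (hiii : forall t : int, tight (fun n => distribution (Pn n) (Yn n t)))
  (hiv : stationary_distribution kappa (law1 Y p) /\
     forall nu : probability 'rV[R]_p R, stationary_distribution kappa nu ->
       forall A, measurable A -> nu A = law1 Y p A) :
  forall k : nat, weak_cvg (fun n => law1 (Yn n) k) (law1 Y k).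
Proof.
move=> k f cf [B [_ fB]].
have bf : bounded_continuous f.
  by split => //; exists (B + 1) => x; apply: (fB (B + 1)) => //; rewrite ltrDl.
have [_ hunique] := hiv.
have := law1_cvg hnormd hmarkov hkappa hstatn hmarkovn hkappan hi
  (near_dist_d hnormd hnormp hii) hiii hunique (k := k) bf.
have bmf := bc_bm bf.
rewrite bm_integralE//.
rewrite [X in _ -> X @ _ --> _](_ : _ =
    (fun n => (\int[law1 (Yn n) k]_x f x)%:E)).
  by move=> h; apply: cvg_EFin => //; exact: nearW.
by apply/funext => n; rewrite bm_integralE.
Qed.
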